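(* Let $g_{\alpha\beta}=g_{\alpha\beta}(x^{\gamma})$ be a nondegenerate metric tensor with Laplace operator $\Delta$, let $C^{\alpha}=C^{\alpha}(x^{\gamma})$ be a vector field, and consider the linear evolution equation $$\Delta u-C^{\alpha}u_{,\alpha}-u_{,t}=0$$ for $u=u(t,x^{\alpha})$. The Lie point symmetries of this equation are generated by the homothetic algebra of $g_{\alpha\beta}$. More precisely, let $Y_I=Y_I^{\alpha}(x^{\beta})\partial_{\alpha}$, $I=1,\dots,\dim G_H$, be a basis of the homothetic algebra consisting of Killing vectors ($\psi_I=0$) and, if one exists, a proper homothetic vector ($\psi_I=1$). Then the general form of the Lie point symmetry vector is $$X=\Big(c_{1}+2\psi_{I}\int T^{I}(t)\,dt\Big)\partial_t+T^{I}(t)\,Y_{I}^{\alpha}(x^{\beta})\,\partial_{\alpha}+\big(a(x^{\beta},t)\,u+b(x^{\beta},t)+c_{2}u\big)\partial_{u}$$ (summation over $I$), where $c_1,c_2$ are constants, $T^I(t)$ are functions of $t$, the functions $a(x^{\beta},t)$ and $b(x^{\beta},t)$ are solutions of the evolution equation above, i.e. $$\Delta a-C^{\alpha}a_{,\alpha}-a_{,t}=0,\qquad \Delta b-C^{\alpha}b_{,\alpha}-b_{,t}=0,$$ and the following condition holds: $$T^{I}\,\mathcal{L}_{Y_{I}}C_{\alpha}-T^{I}_{,t}\,Y_{I\alpha}-2a_{,\alpha}=0 .$$ That is, a vector field is a Lie point symmetry of the equation if and only if it is of this form with these conditions satisfied.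
   Context: All functions and tensors are smooth. The coordinates $x^{\alpha}$ are local coordinates on an $n$-dimensional space, $t$ is an additional independent variable, $u$ is the dependent variable, and commas denote partial derivatives. The Laplace operator is $$\Delta=\frac{1}{\sqrt{|g|}}\frac{\partial}{\partial x^{\alpha}}\Big(\sqrt{|g|}\,g^{\alpha\beta}\frac{\partial}{\partial x^{\beta}}\Big).$$ Indices are lowered with the metric: $C_{\alpha}=g_{\alpha\beta}C^{\beta}$, $Y_{I\alpha}=g_{\alpha\beta}Y_I^{\beta}$; $\mathcal{L}_{Y_I}C_{\alpha}$ denotes the Lie derivative along $Y_I$ of the covector field $C_{\alpha}$. A homothetic vector of $g$ is a vector field $Y$ with $\mathcal{L}_Y g_{\alpha\beta}=2\psi g_{\alpha\beta}$, $\psi$ a constant called the homothetic factor; it is a Killing vector if $\psi=0$. The homothetic algebra is the Lie algebra of all homothetic vectors, and $\dim G_H$ is its dimension. A Lie point symmetry of a differential equation $\Theta(x^k,u,u_{,i},u_{,ij})=0$ is a vector field $X=\xi^{i}(x^{k},u)\partial_{i}+\eta(x^{k},u)\partial_{u}$ on the space of independent variables (here $t,x^{\alpha}$) and dependent variable whose second prolongation $X^{[2]}$ satisfies $X^{[2]}\Theta=0$ whenever $\Theta=0$. *)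

(* Defs.v *)
From mathcomp Require Import all_boot all_order all_algebra.
From mathcomp Require Import all_classical all_reals all_analysis.
Import Order.TTheory GRing.Theory Num.Theory.
Import numFieldNormedType.Exports.

Set Implicit Arguments.
Unset Strict Implicit.
Unset Printing Implicit Defensive.

Local Open Scope classical_set_scope.
Local Open Scope ring_scope.

(* C^oo on D (an open set in all uses): every iterated directional derivative
   of f, of any order and along any constant vectors, is differentiable at
   every point of D. *)
Definition smooth_on (R : realType) (E : normedModType R) (D : set E)
    (f : E -> R) : Prop :=
  forall (s : seq E) (x : E), D x ->
    differentiable (foldr (fun (v : E) (h : E -> R) => 'D_v h) f s) x.

Definition basis_vec {R : realType} {n : nat} (i : 'I_n) : 'rV[R]_n :=
  delta_mx 0 i.

Definition partial (R : realType) (n : nat) (i : 'I_n)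
    (f : 'rV[R]_n -> R) : 'rV[R]_n -> R :=
  'D_(basis_vec i) f.

Section Geometry.
Variables (R : realType) (n : nat).

(* Vector fields are given by their contravariant components Y^a = Y x 0 a,
   covector fields by their components, the metric by g_{ab} = g x a b. *)
Implicit Types (U : set 'rV[R]_n) (g : 'rV[R]_n -> 'M[R]_n)
  (Y C : 'rV[R]_n -> 'rV[R]_n) (w : 'I_n -> 'rV[R]_n -> R).

Definition smooth_metric U g : Prop :=
  [/\ forall i j, smooth_on U (fun x => g x i j),
      forall x, U x -> (g x)^T = g x
    & forall x, U x -> g x \in unitmx].

Definition smooth_field U Y : Prop :=
  forall i, smooth_on U (fun x => Y x 0 i).

Definition vol g (x : 'rV[R]_n) : R := Num.sqrt `|\det (g x)|.

Definition ginv g (x : 'rV[R]_n) : 'M[R]_n := invmx (g x).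

Definition laplacian g (f : 'rV[R]_n -> R) (x : 'rV[R]_n) : R :=
  (vol g x)^-1 *
  \sum_a partial a
    (fun y => \sum_b vol g y * ginv g y a b * partial b f y) x.

Definition lower g Y (a : 'I_n) (x : 'rV[R]_n) : R :=
  \sum_b g x a b * Y x 0 b.

Definition lie_metric Y g (a b : 'I_n) (x : 'rV[R]_n) : R :=
  \sum_c (Y x 0 c * partial c (fun y => g y a b) x
          + g x c b * partial a (fun y => Y y 0 c) x
          + g x a c * partial b (fun y => Y y 0 c) x).

Definition lie_covector Y w (a : 'I_n) (x : 'rV[R]_n) : R :=
  \sum_c (Y x 0 c * partial c (w a) x
          + w c x * partial a (fun y => Y y 0 c) x).

Definition homothetic U g Y (psi : R) : Prop :=
  smooth_field U Y /\
  forall x, U x -> forall a b, lie_metric Y g a b x = 2 * psi * g x a b.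

(* Y is a basis, with homothetic factors psi, of the real vector space of
   homothetic vectors of g on U; fields are compared on U only. *)
Definition homothetic_basis U g (m : nat) (Y : 'I_m -> 'rV[R]_n -> 'rV[R]_n)
    (psi : 'I_m -> R) : Prop :=
  [/\ forall I, homothetic U g (Y I) (psi I),
      forall k : 'I_m -> R,
        (forall x, U x -> \sum_I k I *: Y I x = 0) -> forall I, k I = 0
    & forall Z phi, homothetic U g Z phi ->
        exists k : 'I_m -> R, forall x, U x -> Z x = \sum_I k I *: Y I x].

Definition killing_or_proper (m : nat) (psi : 'I_m -> R) : Prop :=
  (forall I, psi I = 0 \/ psi I = 1) /\
  (forall I K, psi I = 1 -> psi K = 1 -> I = K).

End Geometry.

(* Jets of one dependent variable u over N independent variables z^i:
   (z, u), (z, u, (u_i)) and (z, u, (u_i), (u_ij)). *)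
Notation jet0 R N := ('rV[R]_N * R)%type.
Notation jet1 R N := ('rV[R]_N * R * 'rV[R]_N)%type.
Notation jet2 R N := ('rV[R]_N * R * 'rV[R]_N * 'M[R]_N)%type.

Section Prolongation.
Variables (R : realType) (N : nat).

(* Total derivatives D_i = d/dz^i + u_i d/du + u_ij d/du_j, written as
   derivatives along the corresponding direction in jet space. *)
Definition total1 (i : 'I_N) (F : jet0 R N -> R) (j : jet1 R N) : R :=
  let: (z, u, p) := j in
  'D_((basis_vec i, p 0 i) : jet0 R N) F (z, u).

Definition total2 (i : 'I_N) (F : jet1 R N -> R) (j : jet2 R N) : R :=
  let: (z, u, p, q) := j in
  'D_((basis_vec i, p 0 i, row i q) : jet1 R N) F (z, u, p).

(* eta_i = D_i eta - u_k D_i xi^k  and  eta_ij = D_j eta_i - u_ik D_j xi^k. *)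
Definition prol1 (xi : jet0 R N -> 'rV[R]_N) (eta : jet0 R N -> R)
    (i : 'I_N) (j : jet1 R N) : R :=
  let: (z, u, p) := j in
  total1 i eta j - \sum_k p 0 k * total1 i (fun w => xi w 0 k) j.

Definition prol2 (xi : jet0 R N -> 'rV[R]_N) (eta : jet0 R N -> R)
    (i k : 'I_N) (j : jet2 R N) : R :=
  let: (z, u, p, q) := j in
  total2 k (prol1 xi eta i) j
  - \sum_l q i l * total1 k (fun w => xi w 0 l) (z, u, p).

(* X^[2] Theta, the action on Theta of the second prolongation of
   X = xi^i d/dz^i + eta d/du. *)
Definition prolong (xi : jet0 R N -> 'rV[R]_N) (eta : jet0 R N -> R)
    (Theta : jet2 R N -> R) (j : jet2 R N) : R :=
  let: (z, u, p, q) := j in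
  'D_((xi (z, u), eta (z, u),
       \row_i prol1 xi eta i (z, u, p),
       \matrix_(i, k) prol2 xi eta i k j) : jet2 R N) Theta j.

(* The jets range over all of the second jet space above Om; Theta is given on
   arbitrary matrices (u_ij) but only the symmetric ones are jets.  The
   direction in [prolong] is tangent to the symmetric ones when xi and eta are
   smooth. *)
Definition lie_point_symmetry (Om : set (jet0 R N)) (Theta : jet2 R N -> R)
    (xi : jet0 R N -> 'rV[R]_N) (eta : jet0 R N -> R) : Prop :=
  forall (z : 'rV[R]_N) (u : R) (p : 'rV[R]_N) (q : 'M[R]_N),
    Om (z, u) -> q^T = q ->
    Theta (z, u, p, q) = 0 -> prolong xi eta Theta (z, u, p, q) = 0.

End Prolongation.

Section Evolution.
Variables (R : realType) (n : nat).

(* The independent variables (t, x) are packed as z : 'rV_(1 + n). *)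
Definition pt (t : R) (x : 'rV[R]_n) : 'rV[R]_(1 + n) :=
  row_mx (const_mx t) x.
Definition tidx : 'I_(1 + n) := lshift n 0.
Definition xidx (a : 'I_n) : 'I_(1 + n) := rshift 1 a.
Definition xpart (z : 'rV[R]_(1 + n)) : 'rV[R]_n := rsubmx z.

Definition spacetime (J : set R) (U : set 'rV[R]_n) : set 'rV[R]_(1 + n) :=
  [set z : 'rV[R]_(1 + n) | J (z 0 tidx) /\ U (xpart z)].

(* Delta f - C^a f_,a - f_,t for a function f of (t, x). *)
Definition evol_op (g : 'rV[R]_n -> 'M[R]_n) (C : 'rV[R]_n -> 'rV[R]_n)
    (f : 'rV[R]_(1 + n) -> R) (t : R) (x : 'rV[R]_n) : R :=
  laplacian g (fun y => f (pt t y)) x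
  - \sum_a C x 0 a * partial a (fun y => f (pt t y)) x
  - derive1 (fun s => f (pt s x)) t.

(* The same operator as a function on jets: the outer derivative in the
   divergence form of the Laplacian becomes a total derivative. *)
Definition evol_eq (g : 'rV[R]_n -> 'M[R]_n) (C : 'rV[R]_n -> 'rV[R]_n)
    (j : jet2 R (1 + n)) : R :=
  let: (z, u, p, q) := j in
  (vol g (xpart z))^-1 *
    \sum_a total2 (xidx a)
      (fun k : jet1 R (1 + n) =>
         let: (z', u', p') := k in
         \sum_b vol g (xpart z') * ginv g (xpart z') a b * p' 0 (xidx b)) j
  - \sum_a C (xpart z) 0 a * p 0 (xidx a)
  - p 0 tidx.

End Evolution.

(* Main.v *)
(* The vector field is split as X = tau d_t + xi^a d_a + eta d_u.  On symmetric
   2-jets the equation is u_t = G^ab u_ab + E^b u_b, with G the inverse metric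
   and E^b = Gam^b - C^b, Gam^b = (vol)^-1 d_a (vol G^ab).  The prolongation,
   restricted to the equation, is a polynomial in the remaining jet variables
   u_ta, u_ab, u_a, so it vanishes iff its coefficients do.  The coefficient
   of u_ta gives tau = tau(t), that of u_ab u_c gives xi^a_u = 0, that of
   u_a u_b gives eta_uu = 0, and that of u_ab gives L_xi G = - tau_t G: for each
   t, xi is homothetic with factor tau_t / 2, hence xi = T^I(t) Y_I with
   2 psi_I T^I = tau_t.  The u-free part says that both coefficients of
   eta = a u + b solve the equation.  In the coefficient of u_c the terms with
   Gam cancel, because the contracted Lie derivative of the Levi-Civita
   connection along a homothetic field vanishes; what is left is the condition
   on a, C and T^I with its index raised. *)
Require Import Defs.
From mathcomp Require Import all_boot all_order all_algebra.
From mathcomp Require Import all_classical all_reals all_analysis.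
From mathcomp Require Import perm ring lra.
Import Order.TTheory GRing.Theory Num.Theory.
Import numFieldNormedType.Exports.

Local Open Scope classical_set_scope.
Local Open Scope ring_scope.

Set Implicit Arguments.
Unset Strict Implicit.
Unset Printing Implicit Defensive.

(** * Directional derivatives and smooth functions *)

(** The overview reads off coefficients; in the proof they are reached by substitution. The equation
    is solved for u_t, so the other jet variables are free, and special values (zero, opposite
    signs, the identity matrix, sums of vectors) isolate each coefficient, up to a contraction with
    the metric in which nondegeneracy enters. The mixed derivatives u_ta have to be split off first:
    the reduced polynomial has its short form only once tau is known to depend on t alone. The
    expansion of xi in the homothetic basis is obtained separately for each t, which says nothing
    about how T^I varies with t. Smoothness of T^I comes from inverting a constant matrix of basis
    components taken at finitely many points. The determining equations are local. The closed form
    is global because U is connected and J, W are intervals: vanishing derivatives give constants,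
    and local antiderivatives of T^I fit together over J. All functions are total but controlled
    only on an open set, so derivatives are repeatedly computed after replacing a function by
    another that agrees with it on that set. *)

Section SmoothCalculus.
Variables (R : realType).
Implicit Types E F : normedModType R.

(* A copy of [is_derive] that is not a class, so that typeclass resolution
   does not try to solve its instances. *)
Definition ddir (E : normedModType R) (x v : E) (f : E -> R) (l : R) : Prop :=
  is_derive x v f l.

Lemma ddirE E (x v : E) f l : ddir x v f l -> 'D_v f x = l.
Proof. by case. Qed.

Lemma differentiable_ddir E (x v : E) (f : E -> R) :
  differentiable f x -> ddir x v f ('D_v f x).
Proof. by move=> df; split => //; exact: diff_derivable. Qed.

Lemma ddir_eq E (x v : E) f l l' : ddir x v f l -> l = l' -> ddir x v f l'.
Proof. by move=> h <-. Qed.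

Lemma ddir_cst E (x v : E) (c : R) : ddir x v (fun=> c) 0.
Proof. exact: is_derive_cst. Qed.

Lemma ddirD E (x v : E) f g a b :
  ddir x v f a -> ddir x v g b -> ddir x v (fun y => f y + g y) (a + b).
Proof. exact: is_deriveD. Qed.

Lemma ddirN E (x v : E) f a : ddir x v f a -> ddir x v (fun y => - f y) (- a).
Proof. exact: is_deriveN. Qed.

Lemma ddirB E (x v : E) f g a b :
  ddir x v f a -> ddir x v g b -> ddir x v (fun y => f y - g y) (a - b).
Proof. by move=> hf hg; apply: (ddirD hf (ddirN hg)). Qed.

Lemma ddirM E (x v : E) f g a b :
  ddir x v f a -> ddir x v g b ->
  ddir x v (fun y => f y * g y) (a * g x + f x * b).
Proof.
move=> hf hg; have := is_deriveM hf hg.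
by rewrite addrC /GRing.scale /= (mulrC (g x)).
Qed.

Lemma ddirMl E (x v : E) (c : R) f a :
  ddir x v f a -> ddir x v (fun y => c * f y) (c * a).
Proof.
move=> hf; apply: ddir_eq (ddirM (ddir_cst x v c) hf) _.
by rewrite mul0r add0r.
Qed.

Lemma ddirV E (x v : E) f a :
  f x != 0 -> ddir x v f a ->
  ddir x v (fun y => (f y)^-1) (- (a * ((f x)^-1 * (f x)^-1))).
Proof.
move=> f0 [hf <-]; split; first exact: derivableV.
by rewrite deriveV // /GRing.scale /= expr2 invfM mulrC mulrN.
Qed.

Lemma ddir_sum E (x v : E) (I : finType) (P : pred I) f (a : I -> R) :
  (forall i, P i -> ddir x v (f i) (a i)) ->
  ddir x v (fun y => \sum_(i | P i) f i y) (\sum_(i | P i) a i).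
Proof.
move=> h.
suff: ddir x v (\sum_(i | P i) f i) (\sum_(i | P i) a i).
  by congr ddir; apply/funext => y; rewrite fct_sumE.
elim/big_ind2: _ => //; first exact: ddir_cst.
by move=> ? ? ? ?; exact: ddirD.
Qed.

(** Uniqueness of the list makes the filter [j != i] remove exactly one factor, as the Leibniz rule
    requires. *)
Lemma ddir_prod E (x v : E) (I : eqType) (s : seq I) (f : I -> E -> R)
    (a : I -> R) : uniq s ->
  (forall i, ddir x v (f i) (a i)) ->
  ddir x v (fun y => \prod_(i <- s) f i y)
    (\sum_(i <- s) a i * \prod_(j <- s | j != i) f j x).
Proof.
move=> us h; elim: s us => [_|i s IH /= /andP[nis us]].
  rewrite big_nil; move: (ddir_cst x v 1); congr ddir.
  by apply/funext => y; rewrite big_nil.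
have e : (fun y => \prod_(j <- i :: s) f j y)
       = (fun y => f i y * \prod_(j <- s) f j y).
  by apply/funext => y; rewrite big_cons.
rewrite e; apply: ddir_eq (ddirM (h i) (IH us)) _.
rewrite big_cons big_cons eqxx /=; congr (_ * _ + _).
  rewrite [LHS]big_seq [RHS]big_seq_cond; apply: eq_bigl => j.
  by case: (boolP (j \in s)) => //= js; case: eqP => // ji; rewrite -ji js in nis.
rewrite mulr_sumr [LHS]big_seq [RHS]big_seq; apply: eq_bigr => j js.
rewrite big_cons mulrCA; case: eqP => // ij; by rewrite ij js in nis.
Qed.

(* [L] behaves like an affine map with linear part [l] near [x]; the identity
   holds for the difference quotients themselves. *)
Lemma derive_affine E F (L : E -> F) (x v : E) (w : F) (f : F -> R) :
  (forall h : R, L (h *: v + x) = h *: w + L x) ->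
  'D_v (fun y => f (L y)) x = 'D_w f (L x).
Proof.
by move=> hL; rewrite /derive; under eq_fun do rewrite /= hL.
Qed.

Lemma ddir_affine E F (L : E -> F) (x v : E) (w : F) (f : F -> R) l :
  (forall h : R, L (h *: v + x) = h *: w + L x) ->
  ddir (L x) w f l -> ddir x v (fun y => f (L y)) l.
Proof.
move=> hL [h1 h2]; split; last by rewrite (derive_affine _ hL).
by move: h1; rewrite /derivable; under eq_fun do rewrite /= -hL.
Qed.

Lemma derive_eq_on E (D : set E) (f g : E -> R) v :
  open D -> (forall x, D x -> f x = g x) ->
  forall x, D x -> 'D_v f x = 'D_v g x.
Proof.
move=> oD fg x Dx; apply: near_eq_derive.
by apply: filterS (open_nbhs_nbhs (conj oD Dx)).
Qed.

Lemma ddir_eq_on E (D : set E) (f g : E -> R) v x l :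
  open D -> (forall x, D x -> f x = g x) -> D x ->
  ddir x v f l -> ddir x v g l.
Proof.
move=> oD fg Dx; apply: near_eq_is_derive.
by apply: filterS (open_nbhs_nbhs (conj oD Dx)).
Qed.

(** The single case in which a differential is exhibited by hand: near [x] the remainder is zero, so
    the zero map serves. Locality of differentiability follows from it through g = f + (g - f). *)
Lemma differentiable_near0 E (h : E -> R) x :
  (\forall y \near x, h y = 0) -> differentiable h x.
Proof.
move=> h0.
have dh : h \o shift x = cst (h x) + (0 : E -> R) +o_ 0 id.
  apply/eqaddoP => _/posnumP[e].
  move: (h0); rewrite (near_shift 0 x) subr0.
  apply: filterS => y /= hy.
  by rewrite !fctE /= hy (nbhs_singleton h0) !(addr0, oppr0, normr0) mulr_ge0.
have cont0 : continuous (0 : E -> R) by move=> y; exact: cvg_cst.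
have d0 := diff_unique (df := \0) cont0 dh.
by apply/diff_locallyP; rewrite d0; split.
Qed.

Lemma differentiable_eq_on E (D : set E) (f g : E -> R) x :
  open D -> (forall x, D x -> f x = g x) -> D x ->
  differentiable f x -> differentiable g x.
Proof.
move=> oD fg Dx df.
have -> : g = f + (g - f) by apply/funext => y; rewrite /= addrC subrK.
apply: differentiableD => //; apply: differentiable_near0.
apply: filterS (open_nbhs_nbhs (conj oD Dx)) => y /fg.
by rewrite !fctE => ->; rewrite subrr.
Qed.

End SmoothCalculus.

(** * Closure properties of smooth functions *)

Section SmoothAlgebra.
Variables (R : realType) (E : normedModType R) (D : set E).
Hypothesis oD : open D.
Implicit Types f g : E -> R.

Lemma smooth_differentiable f x : smooth_on D f -> D x -> differentiable f x.
Proof. by move=> /(_ [::]); apply. Qed.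

Lemma smooth_ddir f x v : smooth_on D f -> D x -> ddir x v f ('D_v f x).
Proof. by move=> sf Dx; apply/differentiable_ddir/smooth_differentiable. Qed.

Lemma smooth_derive f v : smooth_on D f -> smooth_on D ('D_v f).
Proof. by move=> sf s x Dx; have := sf (rcons s v) x Dx; rewrite foldr_rcons. Qed.

(** A coinduction principle: induction on the list of directions never leaves [P]. Closure is asked
    only up to equality on [D], because derivative formulas may fail outside it. *)
Lemma smooth_coind (P : (E -> R) -> Prop) :
  (forall f, P f -> forall x, D x -> differentiable f x) ->
  (forall f v, P f -> exists2 h, P h & forall x, D x -> 'D_v f x = h x) ->
  forall f, P f -> smooth_on D f.
Proof.
move=> Pd PD f Pf s.
suff [h Ph fh] : exists2 h, P h &
    forall x, D x -> foldr (fun v k => 'D_v k) f s x = h x.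
  move=> x Dx; apply: (differentiable_eq_on (f := h) oD) => //.
    by move=> y Dy; rewrite fh.
  exact: Pd.
elim: s => [|v s [h Ph fh]] /=; first by exists f.
have [k Pk hk] := PD h v Ph; exists k => // x Dx.
by rewrite (derive_eq_on v oD fh Dx) hk.
Qed.

Lemma smooth_eq_on f g :
  (forall x, D x -> f x = g x) -> smooth_on D f -> smooth_on D g.
Proof.
move=> fg sf.
apply: (@smooth_coind (fun h => exists2 k, smooth_on D k &
  forall x, D x -> k x = h x)); last by exists f.
- move=> h [k sk kh] x Dx; apply: (differentiable_eq_on oD kh Dx).
  exact: smooth_differentiable.
- move=> h v [k sk kh]; exists ('D_v h) => //; exists ('D_v k).
    exact: smooth_derive.
  exact: derive_eq_on.
Qed.

(** Leibniz and quotient rules mix sums, products and inverses, so no single operation gives a class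
    stable under differentiation. Closing under all of them at once gives one to which
    [smooth_coind] applies. *)
Inductive smooth_gen : (E -> R) -> Prop :=
| smooth_gen_base f : smooth_on D f -> smooth_gen f
| smooth_gen_cst c : smooth_gen (fun=> c)
| smooth_genD f g : smooth_gen f -> smooth_gen g ->
    smooth_gen (fun x => f x + g x)
| smooth_genN f : smooth_gen f -> smooth_gen (fun x => - f x)
| smooth_genM f g : smooth_gen f -> smooth_gen g ->
    smooth_gen (fun x => f x * g x)
| smooth_genV f : smooth_gen f -> (forall x, D x -> f x != 0) ->
    smooth_gen (fun x => (f x)^-1).

Lemma smooth_gen_differentiable f :
  smooth_gen f -> forall x, D x -> differentiable f x.
Proof.
elim=> {f}.
- by move=> f sf x; exact: smooth_differentiable.
- by move=> c x _; exact: differentiable_cst.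
- by move=> f g _ df _ dg x Dx; apply: differentiableD; [exact: df|exact: dg].
- by move=> f _ df x Dx; apply: differentiableN; exact: df.
- by move=> f g _ df _ dg x Dx; apply: differentiableM; [exact: df|exact: dg].
- by move=> f _ df f0 x Dx; apply: differentiableV; [exact: df|exact: f0].
Qed.

Lemma smooth_gen_smooth f : smooth_gen f -> smooth_on D f.
Proof.
apply: smooth_coind f; first exact: smooth_gen_differentiable.
move=> f v Pf; suff [h Ph hf] : exists2 h, smooth_gen h &
    forall x, D x -> ddir x v f (h x).
  by exists h => // x /hf /ddirE.
elim: Pf => {f}.
- move=> f sf; exists ('D_v f); first exact/smooth_gen_base/smooth_derive.
  by move=> x Dx; exact: smooth_ddir.
- by move=> c; exists (fun=> 0); [exact: smooth_gen_cst|move=> ? _; exact: ddir_cst].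
- move=> f g _ [f' sf hf] _ [g' sg hg]; exists (fun x => f' x + g' x).
    exact: smooth_genD.
  by move=> x Dx; apply: ddirD; [exact: hf|exact: hg].
- move=> f _ [f' sf hf]; exists (fun x => - f' x); first exact: smooth_genN.
  by move=> x Dx; apply: ddirN; exact: hf.
- move=> f g Pf [f' sf hf] Pg [g' sg hg].
  exists (fun x => f' x * g x + f x * g' x).
    by apply: smooth_genD; apply: smooth_genM.
  by move=> x Dx; apply: ddirM; [exact: hf|exact: hg].
- move=> f Pf [f' sf hf] f0.
  exists (fun x => - (f' x * ((f x)^-1 * (f x)^-1))).
    by apply: smooth_genN; do 2?apply: smooth_genM => //; exact: smooth_genV.
  by move=> x Dx; apply: ddirV; [exact: f0|exact: hf].
Qed.

Lemma smooth_cst c : smooth_on D (fun=> c).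
Proof. exact/smooth_gen_smooth/smooth_gen_cst. Qed.

Lemma smoothD f g :
  smooth_on D f -> smooth_on D g -> smooth_on D (fun x => f x + g x).
Proof. by move=> *; apply/smooth_gen_smooth/smooth_genD; exact: smooth_gen_base. Qed.

Lemma smoothN f : smooth_on D f -> smooth_on D (fun x => - f x).
Proof. by move=> *; apply/smooth_gen_smooth/smooth_genN; exact: smooth_gen_base. Qed.

Lemma smoothB f g :
  smooth_on D f -> smooth_on D g -> smooth_on D (fun x => f x - g x).
Proof. by move=> sf sg; apply: smoothD => //; exact: smoothN. Qed.

Lemma smoothM f g :
  smooth_on D f -> smooth_on D g -> smooth_on D (fun x => f x * g x).
Proof. by move=> *; apply/smooth_gen_smooth/smooth_genM; exact: smooth_gen_base. Qed.

Lemma smoothV f : smooth_on D f -> (forall x, D x -> f x != 0) ->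
  smooth_on D (fun x => (f x)^-1).
Proof. by move=> *; apply/smooth_gen_smooth/smooth_genV => //; exact: smooth_gen_base. Qed.

Lemma smooth_sum (I : Type) (s : seq I) (P : pred I) (f : I -> E -> R) :
  (forall i, P i -> smooth_on D (f i)) ->
  smooth_on D (fun x => \sum_(i <- s | P i) f i x).
Proof.
move=> sf; elim: s => [|i s IH].
  rewrite (_ : (fun x => _) = (fun=> 0)); first exact: smooth_cst.
  by apply/funext => x; rewrite big_nil.
rewrite (_ : (fun x => _) = (fun x => if P i then f i x + \sum_(j <- s | P j) f j x
    else \sum_(j <- s | P j) f j x)); last first.
  by apply/funext => x; rewrite big_cons.
case Pi: (P i) => //; apply: smoothD => //; exact: sf.
Qed.

Lemma smooth_prod (I : Type) (s : seq I) (P : pred I) (f : I -> E -> R) :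
  (forall i, P i -> smooth_on D (f i)) ->
  smooth_on D (fun x => \prod_(i <- s | P i) f i x).
Proof.
move=> sf; elim: s => [|i s IH].
  rewrite (_ : (fun x => _) = (fun=> 1)); first exact: smooth_cst.
  by apply/funext => x; rewrite big_nil.
rewrite (_ : (fun x => _) = (fun x => if P i then f i x * \prod_(j <- s | P j) f j x
    else \prod_(j <- s | P j) f j x)); last first.
  by apply/funext => x; rewrite big_cons.
case Pi: (P i) => //; apply: smoothM => //; exact: sf.
Qed.

Lemma smooth_det n (A : E -> 'M[R]_n) :
  (forall i j, smooth_on D (fun x => A x i j)) ->
  smooth_on D (fun x => \det (A x)).
Proof.
move=> sA; rewrite /determinant; apply: smooth_sum => s _.
apply: smoothM; first exact: smooth_cst.
by apply: smooth_prod => i _; exact: sA.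
Qed.

Lemma smooth_invmx n (A : E -> 'M[R]_n) :
  (forall i j, smooth_on D (fun x => A x i j)) ->
  (forall x, D x -> A x \in unitmx) ->
  forall i j, smooth_on D (fun x => invmx (A x) i j).
Proof.
move=> sA uA i j.
apply: (@smooth_eq_on (fun x => (\det (A x))^-1 * cofactor (A x) j i)).
  by move=> x Dx; rewrite /invmx uA // !mxE.
apply: smoothM.
  apply: smoothV; first exact: smooth_det.
  by move=> x /uA; rewrite unitmxE unitfE.
rewrite /cofactor; apply: smoothM; first exact: smooth_cst.
by apply: smooth_det => k l; under eq_fun do rewrite !mxE; exact: sA.
Qed.

End SmoothAlgebra.

(** Differentiating k o L along [v] gives the derivative of k along the fixed vector [l v], again
    composed with L; the composites are thus a stable class for [smooth_coind]. *)
Lemma smooth_affine (R : realType) (E F : normedModType R) (D : set E)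
    (D' : set F) (L : E -> F) (l : E -> F) (f : F -> R) :
  open D -> (forall x, D x -> differentiable L x) ->
  (forall x v (h : R), L (h *: v + x) = h *: l v + L x) ->
  (forall x, D x -> D' (L x)) ->
  smooth_on D' f -> smooth_on D (fun x => f (L x)).
Proof.
move=> oD dL hL LD sf.
apply: (@smooth_coind R E D oD (fun h => exists2 k, smooth_on D' k &
  forall x, h x = k (L x))); last by exists f.
- move=> h [k sk /funext ->] x Dx.
  apply: (differentiable_comp (f := L)); first exact: dL.
  by apply: smooth_differentiable sk _; exact: LD.
- move=> h v [k sk /funext ->]; exists (fun x => 'D_(l v) k (L x)).
    by exists ('D_(l v) k) => //; exact: smooth_derive.
  by move=> x _; apply: derive_affine => r; exact: hL.
Qed.

(** * Mean value theorem, symmetry of second derivatives, antiderivatives *)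

Section MeanValue.
Variables (R : realType) (E : normedModType R).
Implicit Types (D : set E) (f : E -> R).

Lemma mvt_dir f (x v : E) (d : R) : 0 < d ->
  (forall s, 0 <= s <= d -> differentiable f (s *: v + x)) ->
  exists2 s, 0 < s < d & f (d *: v + x) - f x = d * 'D_v f (s *: v + x).
Proof.
move=> d0 df.
pose k (s : R) := f (s *: v + x).
have dk s : 0 <= s <= d -> ddir s 1 k ('D_v f (s *: v + x)).
  move=> sd; apply: (@ddir_affine _ _ _ (fun s : R => s *: v + x) s 1 v).
    by move=> h; rewrite [h *: _]mulr1 scalerDl addrA.
  exact/differentiable_ddir/df.
have dki s : s \in `]0, d[ -> is_derive s 1 k ('D_v f (s *: v + x)).
  by rewrite in_itv /= => /andP[s0 sd]; apply: dk; rewrite (ltW s0) (ltW sd).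
have ck : {within `[0, d], continuous k}.
  apply: continuous_in_subspaceT => s; rewrite inE /= in_itv /= => /dk[+ _].
  by move=> /derivable1_diffP /differentiable_continuous.
have [s] := MVT d0 dki ck.
rewrite in_itv /= subr0 mulrC => sd e; exists s => //.
by rewrite -e /k scale0r add0r.
Qed.

(** The mean value theorem is used twice: for the increment [k] of f in direction [w], moving along
    [v], and then for the derivative of f along [v], moving along [w]. *)
Lemma second_difference D f (x v w : E) (d : R) :
  open D -> smooth_on D f -> 0 < d ->
  (forall s t, 0 <= s <= d -> 0 <= t <= d -> D (t *: w + (s *: v + x))) ->
  exists s t, [/\ 0 < s < d, 0 < t < d &
    f (d *: w + (d *: v + x)) - f (d *: v + x) - (f (d *: w + x) - f x)
    = d * (d * 'D_w ('D_v f) (t *: w + (s *: v + x)))].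
Proof.
move=> oD sf d0 hD.
have dd : 0 <= d <= d by rewrite lexx ltW.
have d00 : 0 <= (0 : R) <= d by rewrite lexx ltW.
pose k y := f (d *: w + y) - f y.
have dk s : 0 <= s <= d -> ddir (s *: v + x) v k
    ('D_v f (d *: w + (s *: v + x)) - 'D_v f (s *: v + x)).
  move=> sd; apply: ddirB.
    apply: (@ddir_affine _ _ _ (fun y => d *: w + y) _ v v).
      by move=> h; rewrite addrCA.
    by apply: smooth_ddir sf _; apply: hD.
  by apply: smooth_ddir sf _; have := hD s 0 sd d00; rewrite scale0r add0r.
have [|s sd ek] := @mvt_dir k x v d d0.
  move=> s sd; apply: differentiableB.
    apply: (differentiable_comp (f := fun y => d *: w + y)); first exact: differentiableD.
    by apply: smooth_differentiable sf _; apply: hD.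
  by apply: smooth_differentiable sf _; have := hD s 0 sd d00; rewrite scale0r add0r.
have sd' : 0 <= s <= d by case/andP: sd => *; rewrite !ltW.
have [|t td et] := @mvt_dir ('D_v f) (s *: v + x) w d d0.
  move=> t td; apply: (smooth_differentiable (D := D)); first exact: smooth_derive.
  exact: hD.
exists s, t; split => //; rewrite -et -(ddirE (dk s sd')).
exact: ek.
Qed.

(** The second difference is symmetric in [v] and [w], so it equals d^2 times either mixed
    derivative, each at some point near [x]. If the two mixed derivatives differed at [x],
    continuity would keep them apart at those points. *)
Lemma schwarz D f (x v w : E) : open D -> smooth_on D f -> D x ->
  'D_v ('D_w f) x = 'D_w ('D_v f) x.
Proof.
move=> oD sf Dx; set a := LHS; set b := RHS.
apply/eqP/negPn/negP => ab.
pose e := `|a - b| / 2.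
have e0 : 0 < e by rewrite divr_gt0 // normr_gt0 subr_eq0.
have ca : \forall y \near x, `|a - 'D_v ('D_w f) y| < e.
  have := differentiable_continuous
    (smooth_differentiable (smooth_derive v (smooth_derive w sf)) Dx).
  by move=> /cvgrPdist_lt /(_ _ e0).
have cb : \forall y \near x, `|b - 'D_w ('D_v f) y| < e.
  have := differentiable_continuous
    (smooth_differentiable (smooth_derive w (smooth_derive v sf)) Dx).
  by move=> /cvgrPdist_lt /(_ _ e0).
have nD : \forall y \near x, D y by exact: open_nbhs_nbhs.
have /nbhs_ballP[r r0 hr] : \forall y \near x,
    [/\ D y, `|a - 'D_v ('D_w f) y| < e & `|b - 'D_w ('D_v f) y| < e].
  by move: nD ca cb; apply: filterS3 => y ? ? ?; split.
(* With this side length the whole parallelogram spanned by d v and d w at [x] stays in the ball of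
   radius [r]; the summand 1 covers the case of zero vectors. *)
pose d := r / (`|v| + `|w| + 1) / 2.
have n0 : 0 < `|v| + `|w| + 1 by rewrite ltr_pwDr // addr_ge0.
have d0 : 0 < d by rewrite !divr_gt0.
have inb s t : 0 <= s <= d -> 0 <= t <= d -> ball x r (t *: w + (s *: v + x)).
  move=> /andP[s0 sd] /andP[t0 td].
  rewrite -ball_normE /ball_ /= addrA opprD addrCA subrr addr0 normrN.
  apply: (le_lt_trans (ler_normD _ _)); rewrite !normrZ !ger0_norm //.
  apply: (@le_lt_trans _ _ (d * (`|w| + `|v|))).
    by rewrite mulrDr lerD // ler_wpM2r.
  have -> : r = d * (2 * (`|v| + `|w| + 1)) by rewrite /d; field; rewrite gt_eqF.
  rewrite ltr_pM2l //; have := normr_ge0 v; have := normr_ge0 w; lra.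
have hD s t : 0 <= s <= d -> 0 <= t <= d -> D (t *: w + (s *: v + x)).
  by move=> sd td; case: (hr _ (inb s t sd td)).
have [s [t [sd td est]]] := second_difference oD sf d0 hD.
have hD' s' t' : 0 <= s' <= d -> 0 <= t' <= d -> D (t' *: v + (s' *: w + x)).
  by move=> sd' td'; rewrite addrCA; apply: hD.
have [s' [t' [sd' td' est']]] := second_difference oD sf d0 hD'.
have dn : d != 0 by rewrite gt_eqF.
have aux (p p' q q' o k k' : R) : p' = p -> p - q - (q' - o) = d * (d * k) ->
    p' - q' - (q - o) = d * (d * k') -> k = k'.
  move=> -> h h'; apply: (mulfI dn); apply: (mulfI dn); rewrite -h -h'; ring.
have e2 := aux _ _ _ _ _ _ _ (congr1 f (addrCA (d *: v) (d *: w) x)) est est'.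
have ltW2 (u : R) : 0 < u < d -> 0 <= u <= d.
  by move=> /andP[? ?]; rewrite !ltW.
have [_ _ h1] := hr _ (inb _ _ (ltW2 _ sd) (ltW2 _ td)).
have inb' s0 t0 : 0 <= s0 <= d -> 0 <= t0 <= d -> ball x r (t0 *: v + (s0 *: w + x)).
  by move=> sd0 td0; rewrite addrCA; exact: inb.
have [_ h2 _] := hr _ (inb' _ _ (ltW2 _ sd') (ltW2 _ td')).
have aux2 (p q k k' : R) : k = k' -> `|p - k'| < e -> `|q - k| < e ->
    `|p - q| < e + e.
  move=> <- hp hq; have -> : p - q = (p - k) - (q - k) by ring.
  by apply: (le_lt_trans (ler_normB _ _)); rewrite ltrD.
by have := aux2 _ _ _ _ e2 h2 h1; rewrite /e -splitr ltxx.
Qed.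

(** Segments inside a ball and the mean value theorem give local constancy, so the level set of f
    through [x] is open and closed relative to [D]. *)
Lemma connected_constant D f : open D -> connected D ->
  (forall x, D x -> differentiable f x) ->
  (forall x v, D x -> 'D_v f x = 0) ->
  forall x y, D x -> D y -> f x = f y.
Proof.
move=> oD cD df f0 x y Dx Dy.
have loc z : D z -> \forall z' \near z, D z' /\ f z' = f z.
  move=> Dz; have /nbhs_ballP[r r0 hr] : \forall z' \near z, D z'.
    exact: open_nbhs_nbhs.
  apply/nbhs_ballP; exists r => // z' zz'; split; first exact: hr.
  have inb s : 0 <= s <= 1 -> D (s *: (z' - z) + z).
    move=> /andP[s0 s1]; apply: hr.
    move: zz'; rewrite -!ball_normE /ball_ /= opprD addrCA subrr addr0 normrN.
    rewrite normrZ ger0_norm // distrC => lt.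
    by apply: le_lt_trans lt; rewrite ler_piMl.
  have [|s /andP[s0 s1]] := @mvt_dir f z (z' - z) 1 ltr01.
    by move=> s /inb; exact: df.
  rewrite f0; last by apply: inb; rewrite !ltW.
  by rewrite mulr0 scale1r subrK => /subr0_eq.
pose B := [set z | D z /\ f z = f x].
have /seteqP[_ DB] : B = D.
  apply: cD; first by exists x.
    exists B; last by apply/seteqP; split => z [].
    rewrite openE => z [Dz fz]; rewrite /interior.
    by apply: filterS (loc z Dz) => z' [Dz' fz']; split => //; rewrite fz'.
  exists (~` [set z | D z /\ f z <> f x]).
    apply: open_closedC; rewrite openE => z [Dz fz]; rewrite /interior.
    by apply: filterS (loc z Dz) => z' [Dz' fz']; split => //; rewrite fz'.
  apply/seteqP; split => z [Dz]; first by move=> fz; split => // -[].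
  by move=> nfz; split => //; apply: contrapT => fz; apply: nfz.
by case: (DB y Dy) => _ ->.
Qed.

End MeanValue.

(** * Antiderivatives on an open interval *)

Section Antiderivative.
Variables (R : realType).
Implicit Types (J : set R) (f F T : R -> R).

Lemma derive_1 (f : R -> R) x v : differentiable f x -> 'D_v f x = v * 'D_1 f x.
Proof. by move=> df; rewrite !deriveE // -[v in LHS]mulr1 linearZ. Qed.

Lemma connected_open_interval J : is_interval J -> connected J.
Proof. by move/connected_intervalP. Qed.

Lemma antiderivative_cc T (a b : R) : a < b ->
  (forall x, a <= x <= b -> {for x, continuous T}) ->
  exists F, forall x, a < x < b -> is_derive x 1 F (T x).
Proof.
move=> ab cT.
exists (fun x => \int[@lebesgue_measure R]_(t in `[a, x]) T t)%R.
move=> x /andP[ax xb].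
have iT : (@lebesgue_measure R).-integrable `[a, b] (EFin \o T).
  apply: continuous_compact_integrable; first exact: segment_compact.
  by apply: continuous_in_subspaceT => y; rewrite inE /= in_itv /= => /cT.
have cx : {for x, continuous T} by apply: cT; rewrite !ltW.
have [dF eF] := continuous_FTC1_closed xb iT ax cx.
split; [exact: dF|by rewrite -derive1E; exact: eF].
Qed.

Lemma antiderivative_unique T F G (a b c : R) : a < c < b ->
  (forall x, a < x < b -> is_derive x 1 F (T x)) ->
  (forall x, a < x < b -> is_derive x 1 G (T x)) ->
  F c = G c -> forall x, a < x < b -> F x = G x.
Proof.
move=> acb dF dG Fc x axb.
have dFG y : a < y < b -> ddir y 1 (fun z => F z - G z) 0.
  by move=> /[dup] /dF + /dG; rewrite -(subrr (T y)); exact: ddirB.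
have := @connected_constant R R [set y | a < y < b] (fun z => F z - G z).
move=> /(_ _ _ _ _ x c axb acb) h; apply/eqP; rewrite -subr_eq0.
rewrite h ?Fc ?subrr //.
- rewrite (_ : [set y | a < y < b] = `]a, b[%classic); first exact: interval_open.
  by apply/seteqP; split => y; rewrite /= in_itv.
- apply: connected_open_interval => y z /= /andP[ay yb] /andP[az zb] u /andP[yu uz].
  by rewrite (lt_le_trans ay) //= (le_lt_trans uz).
- by move=> y /dFG[/derivable1_diffP].
- move=> y v /= /dFG[/derivable1_diffP dy ey].
  by rewrite derive_1 // ey mulr0.
Qed.

(** T need not be integrable on all of J, so the integral is taken on compact subintervals only.
    Normalising each local antiderivative to vanish at [t0] makes any two agree where both are
    defined. *)
Lemma antiderivative J T : open J -> is_interval J -> J !=set0 ->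
  (forall t, J t -> {for t, continuous T}) ->
  exists S, forall t, J t -> is_derive t 1 S (T t).
Proof.
move=> oJ iJ [t0 Jt0] cT.
have bnd t : J t -> exists a b, [/\ J a, J b & a < t < b].
  move=> Jt; have /nbhs_ballP[r /= r0 hr] : nbhs t J by exact: open_nbhs_nbhs.
  exists (t - r / 2), (t + r / 2); split; last by rewrite gtrBl ltrDl divr_gt0.
  - apply: hr; rewrite -ball_normE /ball_ /= opprB addrC subrK ger0_norm; first lra.
    by rewrite divr_ge0 ?ltW.
  - apply: hr; rewrite -ball_normE /ball_ /= opprD addNKr normrN ger0_norm; first lra.
    by rewrite divr_ge0 ?ltW.
pose good t a b F := [/\ a < t0 < b, a < t < b, F t0 = 0 &
  forall s, a < s < b -> J s /\ is_derive s 1 F (T s)].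
have ex t : J t -> exists a b F, good t a b F.
  move=> Jt; have [a [b [Ja Jb /andP[at_ tb]]]] := bnd t Jt.
  have [a0 [b0 [Ja0 Jb0 /andP[at0 tb0]]]] := bnd t0 Jt0.
  (* The interval is enlarged to contain both [t] and the base point; order-convexity keeps its
     closure in J. *)
  pose a1 := Num.min a a0; pose b1 := Num.max b b0.
  have Ja1 : J a1 by rewrite /a1; case: ltP.
  have Jb1 : J b1 by rewrite /b1; case: ltP.
  have at1 : a1 < t by rewrite gt_min at_.
  have at01 : a1 < t0 by rewrite gt_min at0 orbT.
  have bt1 : t < b1 by rewrite lt_max tb.
  have bt01 : t0 < b1 by rewrite lt_max tb0 orbT.
  have Jab s : a1 <= s <= b1 -> J s by move=> /andP[? ?]; apply: iJ Ja1 Jb1 _ _; apply/andP.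
  have [|F dF] := antiderivative_cc (T := T) (lt_trans at1 bt1).
    by move=> x /Jab /cT.
  exists a1, b1, (fun x => F x - F t0); split; rewrite ?at1 ?bt1 ?at01 ?bt01 ?subrr //.
  move=> s /[dup] sab /andP[? ?]; split; first by apply: Jab; rewrite !ltW.
  rewrite -(subr0 (T s)); apply: ddirB; [exact: dF|exact: ddir_cst].
have uniq_ t a b F a' b' F' : good t a b F -> good t a' b' F' -> F t = F' t.
  move=> [/andP[h1 h2] /andP[h3 h4] F0 dF] [/andP[h1' h2'] /andP[h3' h4'] F0' dF'].
  apply: (@antiderivative_unique T F F' (Num.max a a') (Num.min b b') t0).
  - by rewrite gt_max lt_min h1 h1' h2 h2'.
  - by move=> x; rewrite gt_max lt_min => /andP[/andP[p _] /andP[q _]]; case: (dF x) => //; apply/andP.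
  - by move=> x; rewrite gt_max lt_min => /andP[/andP[_ p] /andP[_ q]]; case: (dF' x) => //; apply/andP.
  - by rewrite F0 F0'.
  - by rewrite gt_max lt_min h3 h3' h4 h4'.
(* By [uniq_] the set of candidate values at [t] is a singleton on J, so the choice made by [get] is
   forced there. *)
exists (fun t => get [set v | exists a b F, good t a b F /\ F t = v]).
move=> t Jt; have [a [b [F gF]]] := ex t Jt.
have [t0ab tab F0 dF] := gF.
have oab : open [set s | a < s < b].
  rewrite (_ : [set y | a < y < b] = `]a, b[%classic); first exact: interval_open.
  by apply/seteqP; split => y; rewrite /= in_itv.
apply: (@ddir_eq_on _ _ [set s | a < s < b] F _ 1 t _ oab _ tab); last by case: (dF t tab).
move=> s sab; apply/esym.
have gs : good s a b F by [].
have := @getI _ [set v | exists a b F, good s a b F /\ F s = v] (F s).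
case=> [|a' [b' [F' [g' <-]]]]; first by exists a, b, F.
exact: uniq_ g' gs.
Qed.

End Antiderivative.

(** * Volume, Laplacian and Lie derivatives of a metric *)

Section Determinant.
Variables (R : realType) (E : normedModType R).

(** In the differentiated Leibniz formula the permutations are grouped by the value [s i]; each
    group is a cofactor. *)
Lemma ddir_det n (A : E -> 'M[R]_n) (B : 'M[R]_n) (x v : E) :
  (forall i j, ddir x v (fun y => A y i j) (B i j)) ->
  ddir x v (fun y => \det (A y)) (\sum_i \sum_j B i j * cofactor (A x) i j).
Proof.
move=> dA; rewrite /determinant.
apply: (@ddir_eq _ _ _ _ _ (\sum_(s : 'S_n) (-1) ^+ s *
    \sum_i B i (s i) * \prod_(k | k != i) A x k (s k))).
  apply: ddir_sum => s _; apply: ddirMl; apply: ddir_prod.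
    exact: index_enum_uniq.
  by move=> i; exact: dA.
under eq_bigr do rewrite mulr_sumr.
rewrite exchange_big /=; apply: eq_bigr => i _.
rewrite (partition_big (fun s : 'S_n => s i) predT) //=; apply: eq_bigr => j _.
rewrite expand_cofactor mulr_sumr; apply: eq_bigr => s /eqP <-.
rewrite mulrCA; congr (_ * (_ * _)); by apply: eq_bigl => k; rewrite eq_sym.
Qed.

(** The adjugate is the determinant times the inverse; together with [ddir_det] this is Jacobi's
    formula. *)
Lemma sum_cofactor_tr n (A B : 'M[R]_n) : A \in unitmx ->
  \sum_i \sum_j B i j * cofactor A i j = \det A * \tr (invmx A *m B).
Proof.
move=> uA; rewrite /mxtrace mulr_sumr exchange_big; apply: eq_bigr => j _.
rewrite !mxE mulr_sumr; apply: eq_bigr => i _.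
rewrite /invmx uA !mxE mulrC mulrA mulrA divff ?mul1r //.
by rewrite -unitfE -unitmxE.
Qed.

(** Restriction to the line s v + x reduces this to the chain rule in one variable, so f has to be
    derivable only along [v]. *)
Lemma ddir_comp (k : R -> R) (f : E -> R) (x v : E) (a b : R) :
  is_derive (f x) 1 k b -> ddir x v f a -> ddir x v (fun y => k (f y)) (b * a).
Proof.
move=> dk df.
have line (h : E -> R) l : ddir x v h l <->
    is_derive (0 : R) 1 (fun s : R => h (s *: v + x)) l.
  have L0 : (fun s : R => s *: v + x) 0 = x by rewrite scale0r add0r.
  have Ls (s : R) : (fun s : R => s *: v + x) (s *: (1 : R) + 0) =
      s *: v + (fun s : R => s *: v + x) 0.
    by rewrite addr0 scale0r add0r [s *: _]mulr1.
  have De := @derive_affine R R E (fun s : R => s *: v + x) 0 1 v h Ls; rewrite L0 in De.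
  split=> -[d e].
    split; [exact: (derivable1P h x v).1 d|exact: etrans De e].
  split; [exact: (derivable1P h x v).2 d|exact: etrans (esym De) e].
apply/line; move/line: df => df.
by apply: is_derive1_comp => //; rewrite scale0r add0r.
Qed.

(** Dividing by y instead of |y| carries the sign, so one formula serves metrics of either
    determinant sign. *)
Lemma is_derive_sqrt_norm (y : R) : y != 0 ->
  is_derive y 1 (fun z => Num.sqrt `|z|) (Num.sqrt `|y| / 2 / y).
Proof.
move=> y0; have [yn|yp|/eqP] := ltrgt0P y; last by rewrite (negbTE y0).
- have h := is_derive1_sqrt yn.
  apply: (@ddir_eq_on _ R [set z | 0 < z] Num.sqrt _ 1 y _ _ _ yn).
  + exact: open_gt.
  + by move=> z z0; rewrite gtr0_norm.
  apply: ddir_eq h _; rewrite -{3}(sqr_sqrtr (ltW yn)).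
  by field; rewrite sqrtr_eq0 -ltNge.
- have ny : 0 < - y by rewrite oppr_gt0.
  have h := is_derive1_sqrt ny.
  apply: (@ddir_eq_on _ R [set z | z < 0] (fun z => Num.sqrt (- z)) _ 1 y _ _ _ yp).
  + exact: open_lt.
  + by move=> z z0; rewrite ltr0_norm.
  apply: ddir_eq (is_derive1_comp h (is_deriveN (is_derive_id y (1:R)))) _.
  rewrite -{3}(opprK y) -{3}(sqr_sqrtr (ltW ny)).
  by field; rewrite sqrtr_eq0 -ltNge.
Qed.

End Determinant.

(** * Inverse metric, volume density and first-order part of the Laplacian *)

Section Connection.
Variables (R : realType) (n : nat) (U : set 'rV[R]_n) (g : 'rV[R]_n -> 'M[R]_n).
Hypotheses (oU : open U) (hg : smooth_metric U g).
Local Notation G x a b := (ginv g x a b).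

Lemma metric_smooth a b : smooth_on U (fun x => g x a b).
Proof. by case: hg. Qed.

Lemma metric_unit x : U x -> g x \in unitmx.
Proof. by case: hg => _ _; apply. Qed.

Lemma ginv_sym x a b : U x -> G x a b = G x b a.
Proof.
by case: hg => _ h _ /h e; rewrite /ginv -[in RHS]e -trmx_inv mxE.
Qed.

Lemma ginv_smooth a b : smooth_on U (fun x => G x a b).
Proof. by apply: smooth_invmx => //; [exact: metric_smooth|exact: metric_unit]. Qed.

Lemma ginv_mulV x a b : U x -> \sum_c G x a c * g x c b = (a == b)%:R.
Proof.
move=> Ux; have := mulVmx (metric_unit Ux).
by move=> /matrixP /(_ a b); rewrite !mxE.
Qed.

Lemma ginv_mulr x a b : U x -> \sum_c g x a c * G x c b = (a == b)%:R.
Proof.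
move=> Ux; have := mulmxV (metric_unit Ux).
by move=> /matrixP /(_ a b); rewrite !mxE.
Qed.

Definition dmx (A : 'rV[R]_n -> 'M[R]_n) (v x : 'rV[R]_n) : 'M[R]_n :=
  \matrix_(a, b) 'D_v (fun y => A y a b) x.

(** Differentiate ginv g *m g = 1, which holds throughout the open set U, and multiply by the
    inverse on the right. *)
Lemma dmx_ginv v x : U x ->
  dmx (ginv g) v x = - (ginv g x *m dmx g v x *m ginv g x).
Proof.
move=> Ux.
have h : dmx (ginv g) v x *m g x + ginv g x *m dmx g v x = 0.
  apply/matrixP => a b; rewrite !mxE -big_split /=.
  have d : ddir x v (fun y => \sum_c G y a c * g y c b)
     (\sum_c ('D_v (fun y => G y a c) x * g x c b
              + G x a c * 'D_v (fun y => g y c b) x)).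
    apply: ddir_sum => c _; apply: ddirM.
      exact: smooth_ddir _ (ginv_smooth a c) Ux.
    exact: smooth_ddir _ (metric_smooth c b) Ux.
  have d0 : ddir x v (fun y => \sum_c G y a c * g y c b) 0.
    apply: (ddir_eq_on oU _ Ux (ddir_cst x v (a == b)%:R)) => y Uy.
    by rewrite ginv_mulV.
  transitivity ('D_v (fun y => \sum_c G y a c * g y c b) x); last exact: ddirE d0.
  rewrite (ddirE d); apply: eq_bigr => c _; by rewrite !mxE.
have /(congr1 (mulmx^~ (ginv g x))) := h.
rewrite mul0mx mulmxDl -mulmxA mulmxV ?metric_unit // mulmx1.
by move=> /eqP; rewrite addr_eq0 => /eqP.
Qed.

(* d_v ln(vol g), by Jacobi's formula. *)
Definition dlnvol (v x : 'rV[R]_n) : R := \tr (ginv g x *m dmx g v x) / 2.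

Lemma ddir_det_metric v x : U x ->
  ddir x v (fun y => \det (g y)) (\det (g x) * (2 * dlnvol v x)).
Proof.
move=> Ux.
have h := @ddir_det R 'rV[R]_n n g (dmx g v x) x v.
apply: ddir_eq (h _) _.
  move=> i j; rewrite mxE; exact: smooth_ddir _ (metric_smooth i j) Ux.
rewrite sum_cofactor_tr ?metric_unit // /dlnvol; congr (_ * _).
by rewrite mulrC divfK // pnatr_eq0.
Qed.

Lemma det_metric_neq0 x : U x -> \det (g x) != 0.
Proof. by move=> /metric_unit; rewrite unitmxE unitfE. Qed.

Lemma vol_neq0 x : U x -> vol g x != 0.
Proof.
by move=> Ux; rewrite /vol sqrtr_eq0 -ltNge normr_gt0 det_metric_neq0.
Qed.

Lemma ddir_vol v x : U x -> ddir x v (vol g) (vol g x * dlnvol v x).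
Proof.
move=> Ux; have dn := det_metric_neq0 Ux.
have h : ddir x v (vol g) _ := @ddir_comp R 'rV[R]_n (fun z => Num.sqrt `|z|)
  (fun y => \det (g y)) x v _ _ (is_derive_sqrt_norm dn) (ddir_det_metric v Ux).
apply: ddir_eq h _.
rewrite -/(vol g x); move: (vol g x) (\det (g x)) (dlnvol v x) dn => p q r q0.
by field.
Qed.

(** The contracted Christoffel symbols with a minus sign, -G^{ac} Gamma^b_{ac}, expressed through
    the logarithmic derivative of the volume. *)
Definition gam (b : 'I_n) (x : 'rV[R]_n) : R :=
  \sum_a (partial a (fun y => G y a b) x + dlnvol (basis_vec a) x * G x a b).

Lemma ddir_vol_ginv v x a b : U x -> ddir x v (fun y => vol g y * G y a b)
  (vol g x * ('D_v (fun y => G y a b) x + dlnvol v x * G x a b)).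
Proof.
move=> Ux.
apply: ddir_eq (ddirM (ddir_vol v Ux) (smooth_ddir v (ginv_smooth a b) Ux)) _.
by ring.
Qed.

(** Read as half the logarithmic derivative of the determinant, which involves neither square root
    nor absolute value. *)
Lemma dlnvol_smooth v : smooth_on U (dlnvol v).
Proof.
have sd : smooth_on U (fun x => \det (g x)) by apply: smooth_det => //; exact: metric_smooth.
apply: (@smooth_eq_on _ _ _ oU (fun x => (\det (g x))^-1 * 'D_v (fun y => \det (g y)) x * 2^-1)).
  move=> x Ux; rewrite (ddirE (ddir_det_metric v Ux)).
  have := det_metric_neq0 Ux.
  by move: (\det _) (dlnvol v x) => p q p0; field.
apply: smoothM => //; last exact: smooth_cst.
apply: smoothM => //; last exact: smooth_derive.
by apply: smoothV => //; exact: det_metric_neq0.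
Qed.

Lemma gam_smooth b : smooth_on U (gam b).
Proof.
apply: smooth_sum => // a _; apply: smoothD => //.
  exact/smooth_derive/ginv_smooth.
by apply: smoothM => //; [exact: dlnvol_smooth|exact: ginv_smooth].
Qed.

(** [dlnvol] is the differential of ln(vol), hence closed; concretely, Schwarz's theorem is applied
    to the determinant. *)
Lemma dlnvol_closed v w x : U x -> 'D_v (dlnvol w) x = 'D_w (dlnvol v) x.
Proof.
move=> Ux; pose q (y : 'rV[R]_n) := \det (g y).
have sq : smooth_on U q by apply: smooth_det => //; exact: metric_smooth.
have d v' w' : ddir x v' (dlnvol w') (('D_v' ('D_w' q) x * (q x)^-1
   + 'D_w' q x * - ('D_v' q x * ((q x)^-1 * (q x)^-1))) * 2^-1).
  apply: (ddir_eq_on (f := fun y => 2^-1 * ('D_w' q y * (q y)^-1)) oU _ Ux).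
    move=> y Uy; rewrite (ddirE (ddir_det_metric w' Uy)) -/(q y).
    have : q y != 0 by exact: det_metric_neq0.
    by move: (q y) (dlnvol w' y) => p r p0; field.
  rewrite mulrC; apply: ddirMl; apply: ddirM.
    exact: smooth_ddir _ (smooth_derive w' sq) Ux.
  apply: ddirV; first exact: det_metric_neq0.
  exact: smooth_ddir _ sq Ux.
rewrite (ddirE (d v w)) (ddirE (d w v)) (schwarz w v oU sq Ux).
move: ('D_v q x) ('D_w q x) ('D_v ('D_w q) x) (q x) => a b c e.
by ring.
Qed.

Lemma laplacianE f x : smooth_on U f -> U x ->
  laplacian g f x = \sum_a \sum_b G x a b * partial a (partial b f) x
                    + \sum_b gam b x * partial b f x.
Proof.
move=> sf Ux; rewrite /laplacian.
have d a : ddir x (basis_vec a) (fun y => \sum_b vol g y * G y a b * partial b f y)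
   (\sum_b (vol g x * (partial a (fun y => G y a b) x + dlnvol (basis_vec a) x * G x a b)
       * partial b f x + vol g x * G x a b * partial a (partial b f) x)).
  apply: ddir_sum => b _; apply: ddirM; first exact: ddir_vol_ginv.
  exact: smooth_ddir _ (smooth_derive _ sf) Ux.
transitivity ((vol g x)^-1 * \sum_a \sum_b vol g x *
   (G x a b * partial a (partial b f) x +
   (partial a (fun y => G y a b) x + dlnvol (basis_vec a) x * G x a b) * partial b f x)).
  congr (_ * _); apply: eq_bigr => a _; apply: etrans (ddirE (d a)) _.
  by apply: eq_bigr => b _; ring.
under eq_bigr do rewrite -mulr_sumr.
rewrite -mulr_sumr mulrA mulVf ?vol_neq0 // mul1r.
under eq_bigr do rewrite big_split.
rewrite big_split; congr (_ + _).
rewrite exchange_big; apply: eq_bigr => b _.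
by rewrite /gam mulr_suml.
Qed.

End Connection.

Lemma derive_partial (R : realType) n (f : 'rV[R]_n -> R) (x v : 'rV[R]_n) :
  differentiable f x -> 'D_v f x = \sum_c v 0 c * partial c f x.
Proof.
move=> df; rewrite deriveE // {1}(row_sum_delta v) linear_sum.
by apply: eq_bigr => c _; rewrite linearZ /partial deriveE.
Qed.

(* [G a b], [l a], [X a] stand for the inverse metric, the derivative of the
   logarithm of the volume and a vector field at a point; [dG c a b], [dl],
   [P], [ddG], [Q] for their first and second partial derivatives. *)
Lemma lie_gam_algebra (R : comRingType) n (G P dl : 'I_n -> 'I_n -> R)
    (dG Q : 'I_n -> 'I_n -> 'I_n -> R) (ddG : 'I_n -> 'I_n -> 'I_n -> 'I_n -> R)
    (X l : 'I_n -> R) (k : R) (b : 'I_n) :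
  (forall a c, dl a c = dl c a) ->
  (forall a c e d, ddG a c e d = ddG c a e d) ->
  (forall a b, \sum_c (X c * dG c a b - G c b * P c a - G a c * P c b)
               = - k * G a b) ->
  (forall a, \sum_c (P a c * dG c a b + X c * ddG a c a b
      - (dG a c b * P c a + G c b * Q a c a)
      - (dG a a c * P c b + G a c * Q a c b)) = - k * dG a a b) ->
  (forall a, \sum_c (P a c * l c + X c * dl a c + Q a c c) = 0) ->
  (forall a c e, Q a c e = Q c a e) ->
  \sum_c X c * (\sum_a (ddG c a a b + (dl c a * G a b + l a * dG c a b)))
  - \sum_a \sum_c G a c * Q a c b
  - \sum_c (\sum_a (dG a a c + l a * G a c)) * P c b
  = - k * \sum_a (dG a a b + l a * G a b).
Proof.
move=> sdl sddG H1 H2 H3 sQ.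
(* The right-hand side is assembled from the divergence of the homothety equation for G and that
   equation itself contracted with [l]. *)
have e1 : - k * \sum_a (dG a a b + l a * G a b)
        = \sum_a \sum_c (P a c * dG c a b + X c * ddG a c a b
            - (dG a c b * P c a + G c b * Q a c a)
            - (dG a a c * P c b + G a c * Q a c b)
            + l a * (X c * dG c a b - G c b * P c a - G a c * P c b)).
  rewrite mulr_sumr; apply: eq_bigr => a _.
  rewrite mulrDr -(H2 a) mulrCA -(H1 a b) mulr_sumr -big_split.
  by apply: eq_bigr.
have e2 : \sum_a \sum_c G a b * (P a c * l c + X c * dl a c + Q a c c) = 0.
  by rewrite big1 // => a _; rewrite -mulr_sumr H3 mulr0.
have e3 : \sum_a \sum_c P a c * dG c a b = \sum_a \sum_c dG a c b * P c a.
  by rewrite exchange_big; do 2!apply: eq_bigr => ? _; rewrite mulrC.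
(* The gradient of the divergence of X is traded, through the contracted trace identity [e2], for
   second derivatives of the logarithm of the volume. *)
have e4 : \sum_a \sum_c (G c b * Q a c a + l a * (G c b * P c a))
        = - \sum_a \sum_c G a b * (X c * dl a c).
  apply/eqP; rewrite -addr_eq0; apply/eqP; apply: etrans e2.
  rewrite exchange_big -big_split /=.
  apply: eq_bigr => a _; rewrite -big_split; apply: eq_bigr => c _.
  by rewrite (sQ c a) /=; ring.
rewrite e1; apply/eqP; rewrite -subr_eq0; apply/eqP.
have -> : \sum_c X c * (\sum_a (ddG c a a b + (dl c a * G a b + l a * dG c a b)))
   = \sum_a \sum_c (X c * ddG a c a b + l a * (X c * dG c a b))
     + \sum_a \sum_c G a b * (X c * dl a c).
  rewrite [X in _ = X + _]exchange_big [X in _ = _ + X]exchange_big -big_split.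
  apply: eq_bigr => c _.
  rewrite mulr_sumr -big_split; apply: eq_bigr => a _.
  by rewrite (sddG c a) (sdl c a) /=; ring.
have -> : \sum_c (\sum_a (dG a a c + l a * G a c)) * P c b
   = \sum_a \sum_c (dG a a c * P c b + l a * (G a c * P c b)).
  rewrite exchange_big; apply: eq_bigr => c _; rewrite mulr_suml.
  by apply: eq_bigr => a _; ring.
have -> : \sum_a \sum_c (P a c * dG c a b + X c * ddG a c a b
            - (dG a c b * P c a + G c b * Q a c a)
            - (dG a a c * P c b + G a c * Q a c b)
            + l a * (X c * dG c a b - G c b * P c a - G a c * P c b))
   = \sum_a \sum_c P a c * dG c a b - \sum_a \sum_c dG a c b * P c a
   - \sum_a \sum_c (G c b * Q a c a + l a * (G c b * P c a))
   + \sum_a \sum_c (X c * ddG a c a b + l a * (X c * dG c a b))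
   - \sum_a \sum_c G a c * Q a c b
   - \sum_a \sum_c (dG a a c * P c b + l a * (G a c * P c b)).
  rewrite -!sumrB -big_split /= -!sumrB; apply: eq_bigr => a _.
  rewrite -!sumrB -big_split /= -!sumrB; apply: eq_bigr => c _.
  by ring.
rewrite e3 e4; set s1 := \sum_a _; set s2 := \sum_a _; set s3 := \sum_a _.
by ring.
Qed.

(** * Lie derivatives along homothetic fields *)

Section LieIdentities.
Variables (R : realType) (n : nat) (U : set 'rV[R]_n) (g : 'rV[R]_n -> 'M[R]_n).
Hypotheses (oU : open U) (hg : smooth_metric U g).
Local Notation G x a b := (ginv g x a b).
Implicit Types X : 'rV[R]_n -> 'rV[R]_n.

Definition jac X (x : 'rV[R]_n) : 'M[R]_n :=
  \matrix_(a, c) partial a (fun y => X y 0 c) x.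

Lemma lie_metricE X x a b : U x ->
  lie_metric X g a b x
  = (dmx g (X x) x + jac X x *m g x + g x *m (jac X x)^T) a b.
Proof.
move=> Ux; rewrite !mxE /lie_metric.
rewrite derive_partial; last exact: smooth_differentiable (metric_smooth hg a b) Ux.
by rewrite -!big_split; apply: eq_bigr => c _; rewrite !mxE /= (mulrC (partial a _ _)).
Qed.

Definition lie_ginv X (a b : 'I_n) (x : 'rV[R]_n) : R :=
  \sum_c (X x 0 c * partial c (fun y => G y a b) x
    - G x c b * partial c (fun y => X y 0 a) x
    - G x a c * partial c (fun y => X y 0 b) x).

Lemma lie_ginvE X x a b : U x ->
  lie_ginv X a b x
  = - (ginv g x *m (dmx g (X x) x + jac X x *m g x + g x *m (jac X x)^T)
       *m ginv g x) a b.
Proof.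
move=> Ux; have ug := metric_unit hg Ux.
have -> : ginv g x *m (dmx g (X x) x + jac X x *m g x + g x *m (jac X x)^T) *m ginv g x
   = ginv g x *m dmx g (X x) x *m ginv g x + ginv g x *m jac X x
     + (jac X x)^T *m ginv g x.
  rewrite !mulmxDr !mulmxDl; congr (_ + _ + _).
    by rewrite -!mulmxA mulmxV // mulmx1.
  by rewrite !mulmxA mulVmx // mul1mx.
rewrite -[ginv g x *m dmx g (X x) x *m ginv g x]opprK -(dmx_ginv oU hg) // !mxE.
rewrite /lie_ginv derive_partial; last exact: smooth_differentiable (ginv_smooth oU hg a b) Ux.
rewrite !opprD opprK -!sumrN -!big_split; apply: eq_bigr => c _ /=.
by rewrite !mxE mulrC; ring.
Qed.

(** By [lie_ginvE] the Lie derivative of G is minus that of g multiplied by G on both sides, and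
    this is reversible. The prolongation produces the condition on G, the definition of a homothetic
    field the one on g. *)
Lemma lie_metric_ginv X x k : U x ->
  (forall a b, lie_metric X g a b x = k * g x a b) <->
  (forall a b, lie_ginv X a b x = - k * G x a b).
Proof.
move=> Ux; have ug := metric_unit hg Ux.
set L := dmx g (X x) x + jac X x *m g x + g x *m (jac X x)^T.
have e : (forall a b, lie_metric X g a b x = k * g x a b) <-> L = k *: g x.
  split=> [h|h a b]; last by rewrite lie_metricE // -/L h mxE.
  by apply/matrixP => a b; rewrite -lie_metricE // h mxE.
have e' : (forall a b, lie_ginv X a b x = - k * G x a b) <->
    ginv g x *m L *m ginv g x = k *: ginv g x.
  split=> [h|h a b]; last by rewrite lie_ginvE // -/L h mxE mulNr.
  by apply/matrixP => a b; apply: oppr_inj; rewrite -lie_ginvE // h mxE mulNr.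
apply: (iff_trans e); apply: iff_sym; apply: (iff_trans e'); split=> h.
  have -> : L = g x *m (ginv g x *m L *m ginv g x) *m g x.
    by rewrite -!mulmxA mulVmx // mulmx1 mulmxA mulmxV // mul1mx.
  by rewrite h -scalemxAr -scalemxAl mulmxV // mul1mx.
by rewrite h -scalemxAr -scalemxAl mulVmx // mul1mx.
Qed.

(** Half the trace of the homothety equation: the divergence of X with respect to the volume density
    is constant. Its gradient therefore vanishes, as [lie_gam] requires. *)
Lemma lie_trace X x k : U x ->
  (forall a b, lie_metric X g a b x = k * g x a b) ->
  \sum_c (X x 0 c * dlnvol g (basis_vec c) x + partial c (fun y => X y 0 c) x)
  = k * n%:R / 2.
Proof.
move=> Ux h; have ug := metric_unit hg Ux.
(* Reflexivity supplies two copies of the trace: one is expanded into derivatives of g and X, the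
   other evaluated with [h]. *)
have := erefl (\tr (ginv g x *m (\matrix_(a, b) lie_metric X g a b x))).
rewrite {1}(_ : \matrix_(a, b) _ = dmx g (X x) x + jac X x *m g x + g x *m (jac X x)^T);
  last by apply/matrixP => a b; rewrite [LHS]mxE lie_metricE.
rewrite (_ : \matrix_(a, b) _ = k *: g x); last by apply/matrixP => a b; rewrite !mxE h.
rewrite -scalemxAr mulVmx // mxtraceZ mxtrace1 !mulmxDr !mxtraceD !mulmxA.
rewrite mulVmx // mul1mx mxtrace_tr (mxtrace_mulC (ginv g x *m jac X x)) mulmxA mulmxV // mul1mx.
move=> <-; rewrite big_split /=.
have -> : \sum_c partial c (fun y => X y 0 c) x = \tr (jac X x).
  by apply: eq_bigr => c _; rewrite mxE.
have -> : \sum_c X x 0 c * dlnvol g (basis_vec c) x = \tr (ginv g x *m dmx g (X x) x) / 2.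
  have -> : dmx g (X x) x = \sum_c X x 0 c *: dmx g (basis_vec c) x.
    apply/matrixP => a b; rewrite mxE derive_partial; last first.
      exact: smooth_differentiable (metric_smooth hg a b) Ux.
    by rewrite summxE; apply: eq_bigr => c _; rewrite !mxE.
  rewrite mulmx_sumr linear_sum mulr_suml; apply: eq_bigr => c _.
  by rewrite /dlnvol -scalemxAr /= mxtraceZ mulrA.
by move: (\tr _) (\tr _) => p q; field.
Qed.

(* Contraction of the vanishing Lie derivative of the Levi-Civita connection. *)
Lemma lie_gam X k : smooth_field U X ->
  (forall x, U x -> forall a b, lie_metric X g a b x = k * g x a b) ->
  forall x b, U x ->
  \sum_c X x 0 c * partial c (gam g b) x
  - \sum_a \sum_c G x a c * partial a (partial c (fun y => X y 0 b)) x
  - \sum_c gam g c x * partial c (fun y => X y 0 b) x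
  = - k * gam g b x.
Proof.
move=> sX h x b Ux.
have dX v c y : U y -> ddir y v (fun y => X y 0 c) ('D_v (fun y => X y 0 c) y).
  by move=> Uy; exact: smooth_ddir (sX c) Uy.
have ddX v w c y : U y ->
    ddir y v ('D_w (fun y => X y 0 c)) ('D_v ('D_w (fun y => X y 0 c)) y).
  by move=> Uy; exact: smooth_ddir (smooth_derive w (sX c)) Uy.
have dG v a c y : U y -> ddir y v (fun y => G y a c) ('D_v (fun y => G y a c) y).
  by move=> Uy; exact: smooth_ddir (ginv_smooth oU hg a c) Uy.
have ddG v w a c y : U y ->
    ddir y v ('D_w (fun y => G y a c)) ('D_v ('D_w (fun y => G y a c)) y).
  by move=> Uy; exact: smooth_ddir (smooth_derive w (ginv_smooth oU hg a c)) Uy.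
have dl v w y : U y -> ddir y v (dlnvol g w) ('D_v (dlnvol g w) y).
  by move=> Uy; exact: smooth_ddir (dlnvol_smooth oU hg w) Uy.
have dgam c : partial c (gam g b) x =
    \sum_a (partial c (partial a (fun y => G y a b)) x
     + (partial c (dlnvol g (basis_vec a)) x * G x a b
        + dlnvol g (basis_vec a) x * partial c (fun y => G y a b) x)).
  apply: ddirE; apply: ddir_sum => a _; apply: ddirD; first exact: ddG.
  by apply: ddirM; [exact: dl|exact: dG].
under eq_bigr do rewrite dgam.
apply: (@lie_gam_algebra _ _ (fun a c => G x a c)
  (fun a c => partial a (fun y => X y 0 c) x)
  (fun a c => partial a (dlnvol g (basis_vec c)) x)
  (fun c a b => partial c (fun y => G y a b) x)
  (fun a c b => partial a (partial c (fun y => X y 0 b)) x)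
  (fun a c d e => partial a (partial c (fun y => G y d e)) x)
  (fun c => X x 0 c) (fun a => dlnvol g (basis_vec a) x) k b).
- by move=> a c; exact: (dlnvol_closed oU hg _ _ Ux).
- by move=> a c e d; exact: (schwarz _ _ oU (ginv_smooth oU hg e d) Ux).
- by move=> a b'; exact: ((lie_metric_ginv _ _ Ux).1 (h x Ux)).
- move=> a.
  have d1 : ddir x (basis_vec a) (lie_ginv X a b) (\sum_c
     (partial a (fun y => X y 0 c) x * partial c (fun y => G y a b) x
      + X x 0 c * partial a (partial c (fun y => G y a b)) x
      - (partial a (fun y => G y c b) x * partial c (fun y => X y 0 a) x
         + G x c b * partial a (partial c (fun y => X y 0 a)) x)
      - (partial a (fun y => G y a c) x * partial c (fun y => X y 0 b) x
         + G x a c * partial a (partial c (fun y => X y 0 b)) x))).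
    apply: ddir_sum => c _; apply: ddirB; first apply: ddirB.
    + by apply: ddirM; [exact: dX|exact: ddG].
    + by apply: ddirM; [exact: dG|exact: ddX].
    + by apply: ddirM; [exact: dG|exact: ddX].
  (* The homothety equation holds on all of U, so its derivative at [x] may be computed on either
     side. *)
  rewrite -(ddirE d1); apply: ddirE.
  apply: (ddir_eq_on (f := fun y => - k * G y a b) oU _ Ux).
    by move=> y Uy; rewrite ((lie_metric_ginv _ _ Uy).1 (h y Uy)).
  exact/ddirMl/dG.
- move=> a.
  have d1 : ddir x (basis_vec a) (fun y => \sum_c (X y 0 c * dlnvol g (basis_vec c) y
        + partial c (fun y => X y 0 c) y)) (\sum_c
     (partial a (fun y => X y 0 c) x * dlnvol g (basis_vec c) x
      + X x 0 c * partial a (dlnvol g (basis_vec c)) x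
      + partial a (partial c (fun y => X y 0 c)) x)).
    apply: ddir_sum => c _; apply: ddirD; last exact: ddX.
    by apply: ddirM; [exact: dX|exact: dl].
  rewrite -(ddirE d1); apply: ddirE.
  apply: (ddir_eq_on (f := fun y => k * n%:R / 2) oU _ Ux); last exact: ddir_cst.
  by move=> y Uy; rewrite (lie_trace Uy (h y Uy)).
- by move=> a c e; exact: (schwarz _ _ oU (sX e) Ux).
Qed.

(* Both sides are [g] applied to the same vector, since
   L_X (g C) = k g C + g [X, C]. *)
Lemma lie_covector_lower X Z (C : 'rV[R]_n -> 'rV[R]_n) (w : 'I_n -> R) x k :
  U x -> smooth_field U C ->
  (forall a b, lie_metric X g a b x = k * g x a b) ->
  (forall a, lie_covector X (lower g C) a x - lower g Z a x - 2 * w a = 0) <->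
  (forall b, k * C x 0 b + \sum_c (X x 0 c * partial c (fun y => C y 0 b) x
       - C x 0 c * partial c (fun y => X y 0 b) x) - Z x 0 b
       - 2 * \sum_a G x b a * w a = 0).
Proof.
move=> Ux sC h.
pose V b := k * C x 0 b + \sum_c (X x 0 c * partial c (fun y => C y 0 b) x
       - C x 0 c * partial c (fun y => X y 0 b) x) - Z x 0 b
       - 2 * \sum_a G x b a * w a.
suff : (forall a, lie_covector X (lower g C) a x - lower g Z a x - 2 * w a = 0)
    <-> forall b, V b = 0 by [].
have e a : lie_covector X (lower g C) a x - lower g Z a x - 2 * w a
    = \sum_b g x a b * V b.
  have dlow c : partial c (lower g C a) x = \sum_b (partial c (fun y => g y a b) x
      * C x 0 b + g x a b * partial c (fun y => C y 0 b) x).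
    apply: ddirE; apply: ddir_sum => b _; apply: ddirM.
      exact: smooth_ddir (metric_smooth hg a b) Ux.
    exact: smooth_ddir (sC b) Ux.
  have hC : \sum_b C x 0 b * lie_metric X g a b x = k * \sum_b g x a b * C x 0 b.
    rewrite mulr_sumr; apply: eq_bigr => b _; rewrite h; ring.
  have gw : \sum_b g x a b * \sum_c G x b c * w c = w a.
    under eq_bigr do rewrite mulr_sumr.
    rewrite exchange_big /= (bigD1 a) //= [X in _ + X]big1 ?addr0.
      under eq_bigr do rewrite mulrA.
      by rewrite -mulr_suml (ginv_mulr hg) // eqxx mul1r.
    move=> c ca; under eq_bigr do rewrite mulrA.
    by rewrite -mulr_suml (ginv_mulr hg) // eq_sym (negbTE ca) mul0r.
  have -> : \sum_b g x a b * V b = k * (\sum_b g x a b * C x 0 b)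
     + (\sum_b \sum_c g x a b * (X x 0 c * partial c (fun y => C y 0 b) x)
     - \sum_b \sum_c g x a b * (C x 0 c * partial c (fun y => X y 0 b) x))
     - lower g Z a x - 2 * w a.
    rewrite -gw /lower !mulr_sumr -!sumrB -big_split -!sumrB; apply: eq_bigr => b _.
    by rewrite -!mulr_sumr /V sumrB /=; ring.
  congr (_ - _ - _); rewrite -hC /lie_covector /lie_metric.
  have -> : \sum_b \sum_c g x a b * (C x 0 c * partial c (fun y => X y 0 b) x)
    = \sum_b \sum_c g x a c * (C x 0 b * partial b (fun y => X y 0 c) x).
    by rewrite exchange_big.
  under eq_bigr do rewrite dlow /lower mulr_sumr mulr_suml -big_split.
  rewrite exchange_big -sumrB -big_split; apply: eq_bigr => b _ /=.
  rewrite mulr_sumr -sumrB -big_split; apply: eq_bigr => c _ /=.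
  ring.
split=> [hV b|hV a]; last by rewrite e big1 // => b _; rewrite hV mulr0.
(* Raising the index with the inverse metric recovers [V] from its lowered form. *)
have : \sum_a G x b a * \sum_c g x a c * V c = V b.
  under eq_bigr do rewrite mulr_sumr.
  rewrite exchange_big /= (bigD1 b) //= [X in _ + X]big1 ?addr0.
    under eq_bigr do rewrite mulrA.
    by rewrite -mulr_suml (ginv_mulV hg) // eqxx mul1r.
  move=> c cb; under eq_bigr do rewrite mulrA.
  by rewrite -mulr_suml (ginv_mulV hg) // eq_sym (negbTE cb) mul0r.
by move=> <-; rewrite big1 // => a _; rewrite -e hV mulr0.
Qed.

End LieIdentities.

(** * The evolution equation on jets and its prolongation *)

Section Jets.
Variables (R : realType).

Lemma ddir_linear (E : normedModType R) (f : E -> R) (x v : E) (l : R) :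
  (forall h, f (h *: v + x) = h * l + f x) -> ddir x v f l.
Proof.
move=> hf; apply: (@ddir_affine R E R f x v l id); first exact: hf.
exact: is_derive_id.
Qed.

Lemma open_preimage (E F : topologicalType) (f : E -> F) (A : set F) :
  continuous f -> open A -> open (f @^-1` A).
Proof. by move=> /continuousP; apply. Qed.

Lemma fst_continuous (A B : topologicalType) : continuous (@fst A B).
Proof. by move=> x; exact: cvg_fst. Qed.

Lemma snd_continuous (A B : topologicalType) : continuous (@snd A B).
Proof. by move=> x; exact: cvg_snd. Qed.

Variable n : nat.
Local Notation N := (1 + n)%N.

Lemma xpart_continuous : continuous (@xpart R n).
Proof. by move=> z; apply: differentiable_continuous; exact: differentiable_rsubmx. Qed.

Lemma xpart_affine (h : R) (v z : 'rV[R]_N) :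
  xpart (h *: v + z) = h *: xpart v + xpart z.
Proof. by apply/rowP => a; rewrite !mxE. Qed.

Lemma xpart_basis (a : 'I_n) : xpart (basis_vec (xidx a)) = basis_vec a :> 'rV[R]_n.
Proof.
by apply/rowP => b; rewrite !mxE (inj_eq (@rshift_inj _ _)).
Qed.

Lemma xpart_pt (t : R) (x : 'rV[R]_n) : xpart (pt t x) = x.
Proof. exact: row_mxKr. Qed.

Lemma pt_tidx (t : R) (x : 'rV[R]_n) : pt t x 0 (tidx n) = t.
Proof. by rewrite /pt /tidx row_mxEl mxE. Qed.

Lemma pt_xidx (t : R) (x : 'rV[R]_n) a : pt t x 0 (xidx a) = x 0 a.
Proof. by rewrite /pt /xidx row_mxEr. Qed.

Lemma ptK (z : 'rV[R]_N) : pt (z 0 (tidx n)) (xpart z) = z.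
Proof.
apply/rowP => i; case: (split_ordP i) => j ->.
  by rewrite ord1 pt_tidx.
by rewrite pt_xidx mxE.
Qed.

Lemma big_tx (V : nmodType) (F : 'I_N -> V) :
  \sum_i F i = F (tidx n) + \sum_a F (xidx a).
Proof. by rewrite big_split_ord big_ord1. Qed.

Variables (U : set 'rV[R]_n) (g : 'rV[R]_n -> 'M[R]_n) (C : 'rV[R]_n -> 'rV[R]_n).
Hypotheses (oU : open U) (hg : smooth_metric U g) (sC : smooth_field U C).

Definition drift (b : 'I_n) (x : 'rV[R]_n) : R := gam g b x - C x 0 b.

Lemma drift_smooth b : smooth_on U (drift b).
Proof. exact: (smoothB oU (gam_smooth oU hg b) (sC b)). Qed.

(** The total derivative acts on vol G^ab through x and on u_b by inserting u_ab; the prefactor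
    1/vol then cancels, leaving the logarithmic derivative of vol inside [gam]. *)
Lemma evol_eqE z u p q : U (xpart z) ->
  evol_eq g C (z, u, p, q)
  = \sum_a \sum_b ginv g (xpart z) a b * q (xidx a) (xidx b)
    + \sum_b drift b (xpart z) * p 0 (xidx b) - p 0 (tidx n).
Proof.
move=> Ux; set x := xpart z; congr (_ - _).
pose flux a (k : jet1 R N) :=
  \sum_b vol g (xpart k.1.1) * ginv g (xpart k.1.1) a b * k.2 0 (xidx b).
have d a : ddir ((z, u, p) : jet1 R N)
    (basis_vec (xidx a), p 0 (xidx a), row (xidx a) q) (flux a)
    (\sum_b (vol g x * (partial a (fun y => ginv g y a b) x
                        + dlnvol g (basis_vec a) x * ginv g x a b) * p 0 (xidx b)
       + vol g x * ginv g x a b * q (xidx a) (xidx b))).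
  apply: ddir_sum => b _; apply: ddirM.
    apply: (@ddir_affine _ _ _ (fun k : jet1 R N => xpart k.1.1) _ _ (basis_vec a)
      (fun y => vol g y * ginv g y a b)).
      by move=> h; rewrite xpart_affine /= xpart_basis.
    exact: (ddir_vol_ginv oU hg (basis_vec a) a b Ux).
  by apply: ddir_linear => h; rewrite /= !mxE.
transitivity ((vol g x)^-1 * \sum_a \sum_b vol g x *
   (ginv g x a b * q (xidx a) (xidx b) +
   (partial a (fun y => ginv g y a b) x + dlnvol g (basis_vec a) x * ginv g x a b)
     * p 0 (xidx b)) - \sum_a C x 0 a * p 0 (xidx a)).
  congr (_ * _ - _).
  apply: eq_bigr => a _.
  rewrite /total2 (_ : (fun k : jet1 R N => _) = flux a); last first.
    by apply/funext => -[[z' u'] p'].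
  apply: etrans (ddirE (d a)) _.
  by apply: eq_bigr => b _; ring.
under eq_bigr do rewrite -mulr_sumr.
rewrite -mulr_sumr mulrA mulVf ?(vol_neq0 hg) // mul1r.
under eq_bigr do rewrite big_split.
rewrite big_split /= -addrA; congr (_ + _).
rewrite exchange_big -sumrB; apply: eq_bigr => b _.
by rewrite /drift /gam mulrBl mulr_suml.
Qed.

Lemma ddir_evol_eq z u p q (dz : 'rV[R]_N) du dp dq : U (xpart z) ->
  ddir ((z, u, p, q) : jet2 R N) (dz, du, dp, dq) (evol_eq g C)
  (\sum_a \sum_b ('D_(xpart dz) (fun y => ginv g y a b) (xpart z) * q (xidx a) (xidx b)
                  + ginv g (xpart z) a b * dq (xidx a) (xidx b))
   + \sum_b ('D_(xpart dz) (drift b) (xpart z) * p 0 (xidx b)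
             + drift b (xpart z) * dp 0 (xidx b)) - dp 0 (tidx n)).
Proof.
move=> Ux.
pose f (k : jet2 R N) :=
  \sum_a \sum_b ginv g (xpart k.1.1.1) a b * k.2 (xidx a) (xidx b)
    + \sum_b drift b (xpart k.1.1.1) * k.1.2 0 (xidx b) - k.1.2 0 (tidx n).
pose D := (fun k : jet2 R N => xpart k.1.1.1) @^-1` U.
have oD : open D.
  apply: open_preimage => // k; apply: continuous_comp; last exact: xpart_continuous.
  do 2!(apply: continuous_comp; last exact: fst_continuous).
  exact: fst_continuous.
apply: (@ddir_eq_on _ _ D f _ _ _ _ oD) => //.
  by move=> -[[[z' u'] p'] q'] Dz; rewrite evol_eqE.
have dx (F : 'rV[R]_n -> R) : smooth_on U F ->
   ddir ((z, u, p, q) : jet2 R N) (dz, du, dp, dq) (fun k => F (xpart k.1.1.1))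
     ('D_(xpart dz) F (xpart z)).
  move=> sF; apply: (@ddir_affine _ _ _ (fun k : jet2 R N => xpart k.1.1.1) _ _ (xpart dz) F).
    by move=> h; rewrite xpart_affine.
  exact: (smooth_ddir _ sF Ux).
apply: ddirB; last by apply: ddir_linear => h; rewrite /= !mxE.
apply: ddirD.
  apply: ddir_sum => a _; apply: ddir_sum => b _; apply: ddirM.
    exact: dx (ginv_smooth oU hg a b).
  by apply: ddir_linear => h; rewrite /= !mxE.
apply: ddir_sum => b _; apply: ddirM; first exact: dx (drift_smooth b).
by apply: ddir_linear => h; rewrite /= !mxE.
Qed.

End Jets.

(** * Explicit first and second prolongations *)

Section ProlongationFormula.
Variables (R : realType) (N : nat) (Om : set (jet0 R N)).
Hypothesis oOm : open Om.
Implicit Types F : jet0 R N -> R.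

Definition dpz (i : 'I_N) F : jet0 R N -> R := 'D_((basis_vec i, 0) : jet0 R N) F.
Definition dpu F : jet0 R N -> R := 'D_((0, 1) : jet0 R N) F.

(* D_i F and D_k (D_i F) for F(z, u), where u_i = p 0 i and u_ki = q k i. *)
Definition tot1 (p : 'rV[R]_N) (i : 'I_N) F (w : jet0 R N) : R :=
  dpz i F w + p 0 i * dpu F w.
Definition tot2 (p : 'rV[R]_N) (q : 'M[R]_N) (k i : 'I_N) F (w : jet0 R N) : R :=
  tot1 p k (dpz i F) w + (q k i * dpu F w + p 0 i * tot1 p k (dpu F) w).

Lemma dpz_smooth i F : smooth_on Om F -> smooth_on Om (dpz i F).
Proof. exact: smooth_derive. Qed.

Lemma dpu_smooth F : smooth_on Om F -> smooth_on Om (dpu F).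
Proof. exact: smooth_derive. Qed.

Lemma derive_tot1 F w (p : 'rV[R]_N) i : smooth_on Om F -> Om w ->
  'D_((basis_vec i, p 0 i) : jet0 R N) F w = tot1 p i F w.
Proof.
move=> sF Ow; have dF := smooth_differentiable sF Ow.
rewrite /tot1 /dpz /dpu !deriveE //.
have -> : (basis_vec i, p 0 i) = (basis_vec i, 0) + p 0 i *: (0, 1) :> jet0 R N.
  by congr pair; rewrite /= ?scaler0 ?addr0 // add0r [_ *: _]mulr1.
by rewrite linearD linearZ.
Qed.

Lemma total1E F z u (p : 'rV[R]_N) i : smooth_on Om F -> Om (z, u) ->
  total1 i F (z, u, p) = tot1 p i F (z, u).
Proof. by move=> sF Ow; exact: derive_tot1. Qed.

Lemma ddir_fst F (k : jet1 R N) (v : jet0 R N) (r : 'rV[R]_N) l :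
  ddir k.1 v F l -> ddir k ((v, r) : jet1 R N) (fun k => F k.1) l.
Proof. by apply: (@ddir_affine _ _ _ (fun k : jet1 R N => k.1)). Qed.

Lemma ddir_tot1 F z u (p : 'rV[R]_N) k i (q : 'M[R]_N) : smooth_on Om F -> Om (z, u) ->
  ddir ((z, u, p) : jet1 R N) (basis_vec k, p 0 k, row k q)
    (fun j : jet1 R N => tot1 j.2 i F j.1) (tot2 p q k i F (z, u)).
Proof.
move=> sF Ow.
apply: ddirD.
  apply: (@ddir_fst (dpz i F)); rewrite -(derive_tot1 p k (dpz_smooth i sF) Ow).
  exact: (smooth_ddir _ (dpz_smooth i sF) Ow).
apply: ddirM.
  by apply: ddir_linear => h; rewrite /= !mxE.
apply: (@ddir_fst (dpu F)); rewrite -(derive_tot1 p k (dpu_smooth sF) Ow).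
exact: (smooth_ddir _ (dpu_smooth sF) Ow).
Qed.

Variables (xi : jet0 R N -> 'rV[R]_N) (eta : jet0 R N -> R).
Hypotheses (sxi : forall i, smooth_on Om (fun w => xi w 0 i)).
Hypotheses (seta : smooth_on Om eta).

Lemma prol1E z u p i : Om (z, u) ->
  prol1 xi eta i (z, u, p)
  = tot1 p i eta (z, u) - \sum_l p 0 l * tot1 p i (fun w => xi w 0 l) (z, u).
Proof.
move=> Ow; rewrite /prol1 total1E //; congr (_ - _).
by apply: eq_bigr => l _; rewrite total1E //; exact: sxi.
Qed.

Lemma prol2E z u p q i k : Om (z, u) ->
  prol2 xi eta i k (z, u, p, q)
  = tot2 p q k i eta (z, u)
    - \sum_l (q k l * tot1 p i (fun w => xi w 0 l) (z, u)
              + p 0 l * tot2 p q k i (fun w => xi w 0 l) (z, u))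
    - \sum_l q i l * tot1 p k (fun w => xi w 0 l) (z, u).
Proof.
move=> Ow; rewrite /prol2; congr (_ - _); last first.
  by apply: eq_bigr => l _; rewrite total1E //; exact: sxi.
rewrite /total2; apply: ddirE.
pose f (j : jet1 R N) :=
  tot1 j.2 i eta j.1 - \sum_l j.2 0 l * tot1 j.2 i (fun w => xi w 0 l) j.1.
have oD : open ((fun j : jet1 R N => j.1) @^-1` Om).
  by apply: open_preimage => //; exact: fst_continuous.
apply: (@ddir_eq_on _ _ _ f _ _ _ _ oD) => //.
  by move=> -[[z' u'] p'] Dz; rewrite prol1E.
apply: ddirB; first exact: ddir_tot1.
apply: ddir_sum => l _; apply: ddirM; last exact: ddir_tot1 (sxi l) Ow.
by apply: ddir_linear => h; rewrite /= !mxE.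
Qed.

End ProlongationFormula.

(** * Mixed derivatives and the time component *)

Section EvolutionSymmetry.
Variables (R : realType) (n : nat).
Local Notation N := (1 + n)%N.
Variables (U : set 'rV[R]_n) (g : 'rV[R]_n -> 'M[R]_n) (C : 'rV[R]_n -> 'rV[R]_n).
Hypotheses (oU : open U) (hg : smooth_metric U g) (sC : smooth_field U C).
Variable Om : set (jet0 R N).
Hypotheses (oOm : open Om) (OmU : forall w, Om w -> U (xpart w.1)).
Variables (xi : jet0 R N -> 'rV[R]_N) (eta : jet0 R N -> R).
Hypotheses (sxi : forall i, smooth_on Om (fun w => xi w 0 i)).
Hypotheses (seta : smooth_on Om eta).
Local Notation tau := (fun w => xi w 0 (tidx n)).
Local Notation chi c := (fun w => xi w 0 (xidx c)).
Local Notation Gx z a b := (ginv g (xpart z) a b).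
Local Notation Ex z b := (drift g C b (xpart z)).

(** For r the c-th column of the metric, the contraction with G is 2 s_c. Nondegeneracy is used in
    this form for tau, for xi_u and for eta_uu. *)
Lemma ginv_contract_eq0 x (s : 'I_n -> R) : U x ->
  (forall r : 'rV[R]_n, \sum_a \sum_b ginv g x a b * (r 0 b * s a + r 0 a * s b) = 0) ->
  forall c, s c = 0.
Proof.
move=> Ux h c.
have e : \sum_a \sum_b ginv g x a b * g x b c * s a = s c.
  under eq_bigr do rewrite -mulr_suml (ginv_mulV hg) //.
  rewrite (bigD1 c) //= eqxx mul1r big1 ?addr0 // => a /negbTE ->.
  by rewrite mul0r.
have := h (\row_b g x b c).
have -> : \sum_a \sum_b ginv g x a b * ((\row_b g x b c) 0 b * s a
    + (\row_b g x b c) 0 a * s b) = s c + s c.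
  rewrite -e [X in _ = _ + X]exchange_big -big_split /=.
  apply: eq_bigr => a _; rewrite -big_split; apply: eq_bigr => b _.
  by rewrite !mxE /= (ginv_sym hg b a) //; ring.
by lra.
Qed.

(** In the block form of a symmetric second-order jet, [d] is u_tt, [r] collects the u_ta and [Q]
    the u_ab. *)
Lemma jet_block_xx (d : 'M[R]_1) (r : 'rV[R]_n) (Q : 'M[R]_n) a b :
  block_mx d r r^T Q (xidx a) (xidx b) = Q a b.
Proof. exact: block_mxEdr. Qed.

Lemma jet_block_xt (d : 'M[R]_1) (r : 'rV[R]_n) (Q : 'M[R]_n) a :
  block_mx d r r^T Q (xidx a) (tidx n) = r 0 a.
Proof. by rewrite /xidx /tidx block_mxEdl mxE. Qed.

Lemma jet_block_sym (d : 'M[R]_1) (r : 'rV[R]_n) (Q : 'M[R]_n) :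
  Q^T = Q -> (block_mx d r r^T Q)^T = block_mx d r r^T Q.
Proof.
move=> sQ; rewrite tr_block_mx trmxK sQ; congr block_mx.
by apply/matrixP => i j; rewrite !mxE !ord1.
Qed.

Lemma jet_blockP (q : 'M[R]_N) : q^T = q ->
  exists d (r : 'rV[R]_n) (Q : 'M[R]_n), Q^T = Q /\ q = block_mx d r r^T Q.
Proof.
move=> sq; exists (ulsubmx q), (ursubmx q), (drsubmx q).
by rewrite trmx_ursub trmx_drsub sq submxK.
Qed.

Lemma prolong_evol z u p q : Om (z, u) ->
  prolong xi eta (evol_eq g C) (z, u, p, q) =
  \sum_a \sum_b ('D_(xpart (xi (z, u))) (fun y => ginv g y a b) (xpart z)
                    * q (xidx a) (xidx b)
                 + Gx z a b * prol2 xi eta (xidx a) (xidx b) (z, u, p, q))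
  + \sum_b ('D_(xpart (xi (z, u))) (drift g C b) (xpart z) * p 0 (xidx b)
            + Ex z b * prol1 xi eta (xidx b) (z, u, p))
  - prol1 xi eta (tidx n) (z, u, p).
Proof.
move=> Ow; have Ux := OmU Ow; rewrite /prolong.
apply: etrans (ddirE (ddir_evol_eq oU hg sC u p q (xi (z, u)) (eta (z, u)) _ _ Ux)) _.
congr (_ + _ - _); last by rewrite mxE.
  by do 2!(apply: eq_bigr => ? _); rewrite !mxE.
by apply: eq_bigr => ? _; rewrite !mxE.
Qed.

(* The mixed derivatives u_ta enter the prolongation only through tau. *)
Lemma prolong_evol_mixed z u p d r Q : Om (z, u) ->
  prolong xi eta (evol_eq g C) (z, u, p, block_mx d r r^T Q) =
  prolong xi eta (evol_eq g C) (z, u, p, block_mx 0 0 0^T Q)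
  - \sum_a \sum_b Gx z a b * (r 0 b * tot1 p (xidx a) tau (z, u)
                              + r 0 a * tot1 p (xidx b) tau (z, u)).
Proof.
move=> Ow; rewrite !prolong_evol // [RHS]addrAC; congr (_ - _).
rewrite [RHS]addrAC; congr (_ + _).
rewrite -sumrB; apply: eq_bigr => a _; rewrite -sumrB; apply: eq_bigr => b _.
rewrite !jet_block_xx -addrA; congr (_ + _).
rewrite -mulrBr; congr (_ * _).
rewrite !(prol2E oOm sxi seta) // /tot2 !jet_block_xx.
(* Only the time summands of the sums over l meet the block [r]; the spatial ones agree for both
   jets. *)
rewrite !big_tx !jet_block_xt !mxE.
set s1 := \sum_(_ < n) _; set s2 := \sum_(_ < n) _.
set s3 := \sum_(_ < n) _; set s4 := \sum_(_ < n) _.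
have -> : s1 = s3.
  by apply: eq_bigr => c _; rewrite /tot2 !jet_block_xx.
have -> : s2 = s4 by apply: eq_bigr => c _; rewrite !jet_block_xx.
have aux (A B t1 t2 u1 u2 c1 c2 : R) :
  A - (u1 * t1 + B + c1) - (u2 * t2 + c2)
  = A - (0 * t1 + B + c1) - (0 * t2 + c2) - (u1 * t1 + u2 * t2) by ring.
exact: aux.
Qed.

(** Solving for u_t puts the jet on the equation whatever [s], [d], [r] and [Q] are, which makes
    these variables independent. *)
Lemma evol_eq_jet z u (s : 'rV[R]_n) (d : 'M[R]_1) (r : 'rV[R]_n) (Q : 'M[R]_n) : Om (z, u) ->
  evol_eq g C (z, u, pt (\sum_a \sum_b Gx z a b * Q a b + \sum_b Ex z b * s 0 b) s,
               block_mx d r r^T Q) = 0.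
Proof.
move=> Ow; rewrite (evol_eqE C oU hg) ?pt_tidx; last exact: OmU Ow.
apply/eqP; rewrite subr_eq0; apply/eqP; congr (_ + _).
  by do 2!(apply: eq_bigr => ? _); rewrite jet_block_xx.
by apply: eq_bigr => ? _; rewrite pt_xidx.
Qed.

Hypothesis n_gt0 : (0 < n)%N.

(** Two jets on the equation that differ only in u_ta both annihilate the prolongation, so the total
    spatial derivatives of tau vanish for every [s]. Taking s = 0 gives tau_a, and s with all
    entries 1 then gives tau_u. *)
Lemma symmetry_tau : lie_point_symmetry Om (evol_eq g C) xi eta ->
  forall w, Om w -> dpu tau w = 0 /\ forall a, dpz (xidx a) tau w = 0.
Proof.
move=> sym [z u] Ow.
have tot0 (s : 'rV[R]_n) a :
    dpz (xidx a) tau (z, u) + s 0 a * dpu tau (z, u) = 0.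
  pose p := pt (\sum_a \sum_b Gx z a b * (0 : 'M[R]_n) a b + \sum_b Ex z b * s 0 b) s.
  have := @ginv_contract_eq0 (xpart z) (fun a => tot1 p (xidx a) tau (z, u)) (OmU Ow).
  move=> /(_ _ a); rewrite /tot1 /p pt_xidx; apply=> r.
  have P d r' : prolong xi eta (evol_eq g C) (z, u, p, block_mx d r' r'^T 0) = 0.
    apply: sym => //; first by apply: jet_block_sym; rewrite trmx0.
    exact: evol_eq_jet.
  have := P 0 r; rewrite prolong_evol_mixed // P sub0r => /eqP.
  by rewrite oppr_eq0 => /eqP.
have a0 a : dpz (xidx a) tau (z, u) = 0.
  by have := tot0 0 a; rewrite mxE mul0r addr0.
split => //; have := tot0 (const_mx 1) (Ordinal n_gt0).
by rewrite a0 add0r mxE mul1r.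
Qed.

End EvolutionSymmetry.

(* The second prolongation on the equation, with u_t eliminated, as a
   polynomial in the spatial jet variables [s] and [Q]: its homogeneous parts
   are [red_s0], ..., [red_s3], [red_Q] and [red_sQ].  The arrays stand for
   the values at a point of the coefficients and of their derivatives;
   [hau], [Xau] have the z-derivative taken first, [hbu], [Xbu] last. *)
Section ReducedProlongation.
Variables (R : comRingType) (n : nat).
Variables (G dG h2 : 'I_n -> 'I_n -> R) (E dE h1 hau hbu : 'I_n -> R) (hu huu ht tt : R).
Variables (X1 Xau Xbu : 'I_n -> 'I_n -> R) (X2 : 'I_n -> 'I_n -> 'I_n -> R)
  (Xu Xuu Xt : 'I_n -> R).

Definition red_s0 : R := \sum_a \sum_b G a b * h2 a b + \sum_b E b * h1 b - ht.

Definition red_s1 (s : 'I_n -> R) : R :=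
  \sum_a \sum_b G a b * (s b * hau a + s a * hbu b)
  - \sum_a \sum_b \sum_c G a b * (s c * X2 a b c)
  + \sum_b dE b * s b - \sum_b \sum_c E b * (s c * X1 b c)
  + \sum_c s c * Xt c + tt * \sum_b E b * s b.

Definition red_s2 (s : 'I_n -> R) : R :=
  \sum_a \sum_b G a b * (s a * s b * huu)
  - \sum_a \sum_b \sum_c G a b * (s c * (s b * Xau a c + s a * Xbu b c)).

Definition red_s3 (s : 'I_n -> R) : R :=
  - \sum_a \sum_b \sum_c G a b * (s c * s a * s b * Xuu c).

Definition red_Q (Q : 'I_n -> 'I_n -> R) : R :=
  \sum_a \sum_b dG a b * Q a b + tt * \sum_a \sum_b G a b * Q a b
  - \sum_a \sum_b \sum_c G a b * (Q b c * X1 a c + Q a c * X1 b c).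

Definition red_sQ (s : 'I_n -> R) (Q : 'I_n -> 'I_n -> R) : R :=
  - \sum_a \sum_b \sum_c G a b * ((Q b c * s a + Q a c * s b) * Xu c).

(** All occurrences of eta_u, and those of xi_u multiplied by G Q or E s, combine into (hu - sg) P.
    This cancels against the same product coming from eta_t after u_t = P is substituted; only P tt
    is left, and it is shared by [red_s1] and [red_Q]. *)
Lemma reduced_prolongation (s : 'I_n -> R) (Q : 'I_n -> 'I_n -> R) (P : R) :
  (forall a b, Q b a = Q a b) ->
  P = \sum_a \sum_b G a b * Q a b + \sum_b E b * s b ->
  \sum_a \sum_b (dG a b * Q a b + G a b *
    (h2 a b + s b * hau a + (Q b a * hu + s a * (hbu b + s b * huu))
     - \sum_c (Q b c * (X1 a c + s a * Xu c)
               + s c * (X2 a b c + s b * Xau a c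
                        + (Q b a * Xu c + s a * (Xbu b c + s b * Xuu c))))
     - \sum_c Q a c * (X1 b c + s b * Xu c)))
  + \sum_b (dE b * s b + E b * (h1 b + s b * hu - \sum_c s c * (X1 b c + s b * Xu c)))
  - (ht + P * hu - (P * tt + \sum_c s c * (Xt c + P * Xu c)))
  = red_s0 + red_s1 s + red_s2 s + red_s3 s + red_Q Q + red_sQ s Q.
Proof.
move=> sQ defP; set sg := \sum_c s c * Xu c.
have eab : \sum_a \sum_b (dG a b * Q a b + G a b *
    (h2 a b + s b * hau a + (Q b a * hu + s a * (hbu b + s b * huu))
     - \sum_c (Q b c * (X1 a c + s a * Xu c)
               + s c * (X2 a b c + s b * Xau a c
                        + (Q b a * Xu c + s a * (Xbu b c + s b * Xuu c))))
     - \sum_c Q a c * (X1 b c + s b * Xu c)))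
  = \sum_a \sum_b dG a b * Q a b + \sum_a \sum_b G a b * h2 a b
    + \sum_a \sum_b G a b * (s b * hau a + s a * hbu b)
    + \sum_a \sum_b G a b * (s a * s b * huu)
    - \sum_a \sum_b \sum_c G a b * (Q b c * X1 a c + Q a c * X1 b c)
    - \sum_a \sum_b \sum_c G a b * ((Q b c * s a + Q a c * s b) * Xu c)
    - \sum_a \sum_b \sum_c G a b * (s c * X2 a b c)
    - \sum_a \sum_b \sum_c G a b * (s c * (s b * Xau a c + s a * Xbu b c))
    - \sum_a \sum_b \sum_c G a b * (s c * s a * s b * Xuu c)
    + (hu - sg) * \sum_a \sum_b G a b * Q a b.
  rewrite [(hu - sg) * _]mulr_sumr -!big_split /= -!sumrB -big_split /=.
  apply: eq_bigr => a _.
  rewrite [(hu - sg) * _]mulr_sumr -!big_split /= -!sumrB -big_split /=.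
  apply: eq_bigr => b _.
  have -> : \sum_c (Q b c * (X1 a c + s a * Xu c)
               + s c * (X2 a b c + s b * Xau a c
                        + (Q b a * Xu c + s a * (Xbu b c + s b * Xuu c))))
      = \sum_c (Q b c * (X1 a c + s a * Xu c)) + \sum_c s c * X2 a b c
        + \sum_c s c * (s b * Xau a c + s a * Xbu b c)
        + \sum_c (s c * s a * s b * Xuu c) + Q b a * sg.
    rewrite /sg mulr_sumr -!big_split; apply: eq_bigr => c _ /=; ring.
  rewrite -!mulr_sumr.
  have -> : \sum_i (Q b i * X1 a i + Q a i * X1 b i)
     = \sum_i Q b i * (X1 a i + s a * Xu i) + \sum_i Q a i * (X1 b i + s b * Xu i)
       - \sum_i (Q b i * s a + Q a i * s b) * Xu i.
    rewrite -big_split -sumrB; apply: eq_bigr => c _ /=; ring.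
  rewrite (sQ a b); ring.
have eb : \sum_b (dE b * s b + E b * (h1 b + s b * hu
       - \sum_c s c * (X1 b c + s b * Xu c)))
  = \sum_b dE b * s b + \sum_b E b * h1 b + (hu - sg) * (\sum_b E b * s b)
    - \sum_b \sum_c E b * (s c * X1 b c).
  rewrite mulr_sumr -!big_split -sumrB; apply: eq_bigr => b _ /=.
  rewrite -mulr_sumr; have -> : \sum_c s c * (X1 b c + s b * Xu c)
     = \sum_c s c * X1 b c + s b * sg; last by ring.
  rewrite /sg mulr_sumr -big_split; apply: eq_bigr => c _ /=; ring.
have et : \sum_c s c * (Xt c + P * Xu c) = \sum_c s c * Xt c + P * sg.
  rewrite /sg mulr_sumr -big_split; apply: eq_bigr => c _ /=; ring.
rewrite eab eb et defP /red_s0 /red_s1 /red_s2 /red_s3 /red_Q /red_sQ.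
set k1 := \sum_a \sum_b dG a b * Q a b.
set k2 := \sum_a \sum_b G a b * h2 a b.
set k3 := \sum_a \sum_b G a b * Q a b.
set k4 := \sum_b E b * s b.
by ring.
Qed.

Lemma sum2_eq0 (F : 'I_n -> 'I_n -> R) :
  (forall a b, F a b = 0) -> \sum_a \sum_b F a b = 0.
Proof. by move=> h; rewrite big1 // => a _; rewrite big1. Qed.

Lemma sum3_eq0 (F : 'I_n -> 'I_n -> 'I_n -> R) :
  (forall a b c, F a b c = 0) -> \sum_a \sum_b \sum_c F a b c = 0.
Proof. by move=> h; apply: sum2_eq0 => a b; rewrite big1. Qed.

(** Oddness here and evenness of [red_s2] let the two parts be separated by comparing s with -s,
    once the cubic part is known to vanish. *)
Lemma red_s1_opp s : red_s1 (fun a => - s a) = - red_s1 s.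
Proof.
rewrite /red_s1 !opprD !opprK -!sumrN -mulrN -sumrN.
congr (_ + _ + _ + _ + _ + _); last congr (_ * _).
- apply: eq_bigr => a _; rewrite -sumrN; apply: eq_bigr => b _; ring.
- apply: eq_bigr => a _; rewrite -sumrN; apply: eq_bigr => b _; rewrite -sumrN.
  by apply: eq_bigr => c _; ring.
- apply: eq_bigr => b _; ring.
- apply: eq_bigr => a _; rewrite -sumrN; apply: eq_bigr => b _; ring.
- apply: eq_bigr => b _; ring.
- apply: eq_bigr => b _; ring.
Qed.

Lemma red_s2_opp s : red_s2 (fun a => - s a) = red_s2 s.
Proof.
rewrite /red_s2; congr (_ - _); do 2!(apply: eq_bigr => ? _); first by ring.
by apply: eq_bigr => ? _; ring.
Qed.

Lemma red_s2_0 : red_s2 (fun=> 0) = 0.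
Proof. by rewrite /red_s2 sum2_eq0 ?sum3_eq0 ?subr0 => *; ring. Qed.

Lemma red_s3_0 : red_s3 (fun=> 0) = 0.
Proof. by rewrite /red_s3 sum3_eq0 ?oppr0 => *; ring. Qed.

Lemma red_Q_0 : red_Q (fun _ _ => 0) = 0.
Proof.
rewrite /red_Q sum2_eq0 1?[\sum_a \sum_b G a b * 0]sum2_eq0 1?sum3_eq0 => *; ring.
Qed.

Lemma red_sQ_s0 Q : red_sQ (fun=> 0) Q = 0.
Proof. by rewrite /red_sQ sum3_eq0 ?oppr0 => *; ring. Qed.

Lemma red_sQ_Q0 s : red_sQ s (fun _ _ => 0) = 0.
Proof. by rewrite /red_sQ sum3_eq0 ?oppr0 => *; ring. Qed.

Lemma red_QE Q : (forall a b, Q b a = Q a b) ->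
  red_Q Q = \sum_a \sum_b Q a b * (dG a b
    - \sum_c (G c b * X1 c a + G a c * X1 c b) + tt * G a b).
Proof.
move=> sQ; rewrite /red_Q.
have -> : \sum_a \sum_b \sum_c G a b * (Q b c * X1 a c + Q a c * X1 b c)
  = \sum_a \sum_b Q a b * \sum_c (G c b * X1 c a + G a c * X1 c b).
  transitivity (\sum_a \sum_b \sum_c G a b * (Q b c * X1 a c)
     + \sum_a \sum_b \sum_c G a b * (Q a c * X1 b c)).
    do 2!(rewrite -big_split; apply: eq_bigr => ? _ /=).
    by rewrite -big_split; apply: eq_bigr => ? _ /=; ring.
  transitivity (\sum_a \sum_b \sum_c Q a b * (G c b * X1 c a)
     + \sum_a \sum_b \sum_c Q a b * (G a c * X1 c b)); last first.
    do 2!(rewrite -big_split; apply: eq_bigr => ? _ /=).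
    by rewrite mulr_sumr -big_split; apply: eq_bigr => ? _ /=; ring.
  congr (_ + _).
    rewrite exchange_big [RHS]exchange_big; apply: eq_bigr => b _.
    rewrite exchange_big; apply: eq_bigr => a _; apply: eq_bigr => c _.
    by rewrite (sQ a b); ring.
  apply: eq_bigr => a _; rewrite exchange_big.
  by do 2!(apply: eq_bigr => ? _); ring.
rewrite mulr_sumr -big_split -sumrB; apply: eq_bigr => a _ /=.
rewrite mulr_sumr -big_split -sumrB; apply: eq_bigr => b _ /=.
by ring.
Qed.

Lemma red_s1E s : (forall a b, G a b = G b a) -> (forall a, hau a = hbu a) ->
  red_s1 s = \sum_c s c * (2 * (\sum_a G a c * hbu a)
    - \sum_a \sum_b G a b * X2 a b c + dE c - \sum_b E b * X1 b c + Xt c + tt * E c).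
Proof.
move=> sG sh; rewrite /red_s1.
have -> : \sum_a \sum_b G a b * (s b * hau a + s a * hbu b)
   = \sum_c s c * (2 * (\sum_a G a c * hbu a)).
  transitivity (\sum_a \sum_b G a b * (s b * hbu a) + \sum_a \sum_b G a b * (s a * hbu b)).
    do 2!(rewrite -big_split; apply: eq_bigr => ? _ /=); rewrite sh; ring.
  rewrite [X in X + _]exchange_big -big_split; apply: eq_bigr => c _ /=.
  rewrite !mulr_sumr -big_split; apply: eq_bigr => a _ /=.
  by rewrite (sG c a); ring.
have -> : \sum_a \sum_b \sum_c G a b * (s c * X2 a b c)
   = \sum_c s c * \sum_a \sum_b G a b * X2 a b c.
  under eq_bigr do rewrite exchange_big.
  rewrite exchange_big; apply: eq_bigr => c _ /=; rewrite mulr_sumr.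
  by apply: eq_bigr => a _; rewrite mulr_sumr; apply: eq_bigr => b _; ring.
have -> : \sum_b \sum_c E b * (s c * X1 b c) = \sum_c s c * \sum_b E b * X1 b c.
  rewrite exchange_big; apply: eq_bigr => c _; rewrite mulr_sumr.
  by apply: eq_bigr => b _; ring.
rewrite mulr_sumr -sumrB -big_split -sumrB -!big_split; apply: eq_bigr => c _ /=.
by ring.
Qed.

End ReducedProlongation.

(** * Equivalence of the symmetry condition with the determining equations *)

Section DeterminingEquations.
Variables (R : realType) (n : nat).
Local Notation N := (1 + n)%N.
Variables (U : set 'rV[R]_n) (g : 'rV[R]_n -> 'M[R]_n) (C : 'rV[R]_n -> 'rV[R]_n).
Hypotheses (oU : open U) (hg : smooth_metric U g) (sC : smooth_field U C).
Variable Om : set (jet0 R N).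
Hypotheses (oOm : open Om) (OmU : forall w, Om w -> U (xpart w.1)).
Variables (xi : jet0 R N -> 'rV[R]_N) (eta : jet0 R N -> R).
Hypotheses (sxi : forall i, smooth_on Om (fun w => xi w 0 i)).
Hypotheses (seta : smooth_on Om eta).
Local Notation tau := (fun w => xi w 0 (tidx n)).
Local Notation chi c := (fun w => xi w 0 (xidx c)).
Local Notation Gw w := (fun a b => ginv g (xpart w.1) a b).
Local Notation dGw w :=
  (fun a b => 'D_(xpart (xi w)) (fun y => ginv g y a b) (xpart w.1)).
Local Notation Ew w := (fun b => drift g C b (xpart w.1)).
Local Notation dEw w := (fun b => 'D_(xpart (xi w)) (drift g C b) (xpart w.1)).
Local Notation X1w w := (fun a c => dpz (xidx a) (chi c) w).
Local Notation X2w w := (fun a b c => dpz (xidx b) (dpz (xidx a) (chi c)) w).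
Local Notation Xauw w := (fun a c => dpu (dpz (xidx a) (chi c)) w).
Local Notation Xbuw w := (fun b c => dpz (xidx b) (dpu (chi c)) w).
Local Notation Xuw w := (fun c => dpu (chi c) w).
Local Notation Xuuw w := (fun c => dpu (dpu (chi c)) w).
Local Notation Xtw w := (fun c => dpz (tidx n) (chi c) w).
Local Notation h1w w := (fun b => dpz (xidx b) eta w).
Local Notation h2w w := (fun a b => dpz (xidx b) (dpz (xidx a) eta) w).
Local Notation hauw w := (fun a => dpu (dpz (xidx a) eta) w).
Local Notation hbuw w := (fun b => dpz (xidx b) (dpu eta) w).
Local Notation ttw w := (dpz (tidx n) tau w).

Definition cst_eq w : R :=
  red_s0 (Gw w) (h2w w) (Ew w) (h1w w) (dpz (tidx n) eta w).
Definition s1_part w :=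
  red_s1 (Gw w) (Ew w) (dEw w) (hauw w) (hbuw w) (ttw w) (X1w w) (X2w w) (Xtw w).
Definition s2_part w := red_s2 (Gw w) (dpu (dpu eta) w) (Xauw w) (Xbuw w).
Definition s3_part w := red_s3 (Gw w) (Xuuw w).
Definition Q_part w := red_Q (Gw w) (dGw w) (ttw w) (X1w w).
Definition sQ_part w := red_sQ (Gw w) (Xuw w).

(** The hypothesis on tau holds on the open set [Om], so all further derivatives of tau_u and tau_a
    vanish as well, and tau contributes only tau_t. The u_ta are set to zero because
    [prolong_evol_mixed] accounts for them. *)
Lemma prolong_reduced z u (s : 'rV[R]_n) (Q : 'M[R]_n) :
  Om (z, u) -> Q^T = Q ->
  (forall w, Om w -> dpu tau w = 0 /\ forall a, dpz (xidx a) tau w = 0) ->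
  prolong xi eta (evol_eq g C) (z, u,
     pt (\sum_a \sum_b Gw (z, u) a b * Q a b + \sum_b Ew (z, u) b * s 0 b) s,
     block_mx 0 0 0^T Q)
  = cst_eq (z, u) + s1_part (z, u) (s 0) + s2_part (z, u) (s 0)
    + s3_part (z, u) (s 0) + Q_part (z, u) (fun a b => Q a b)
    + sQ_part (z, u) (s 0) (fun a b => Q a b).
Proof.
move=> Ow sQ tau0; set P := _ + _.
have sQ' a b : Q b a = Q a b by rewrite -{1}sQ mxE.
have [tu ta] := tau0 _ Ow.
have d0 (F : jet0 R N -> R) (v : jet0 R N) : (forall w, Om w -> F w = 0) -> 'D_v F (z, u) = 0.
  move=> F0; apply: ddirE; apply: (ddir_eq_on oOm _ Ow (ddir_cst _ _ 0)).
  by move=> w Ow'; rewrite F0.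
have tot1tau a : tot1 (pt P s) (xidx a) tau (z, u) = 0.
  by rewrite /tot1 ta tu mulr0 addr0.
have tot2tau q b a : tot2 (pt P s) q b (xidx a) tau (z, u) = 0.
  have e1 v : 'D_v (dpz (xidx a) tau) (z, u) = 0 by apply: d0 => w /tau0[].
  have e2 v : 'D_v (dpu tau) (z, u) = 0 by apply: d0 => w /tau0[].
  rewrite /tot2 tu /tot1 [dpz b (dpz _ _) _]e1 [dpu (dpz _ _) _]e1.
  by rewrite [dpz b (dpu _) _]e2 [dpu (dpu _) _]e2 !(mulr0, addr0).
rewrite (prolong_evol oU hg sC OmU) //.
have red := @reduced_prolongation R n (Gw (z, u)) (dGw (z, u)) (h2w (z, u))
  (Ew (z, u)) (dEw (z, u)) (h1w (z, u)) (hauw (z, u)) (hbuw (z, u)) (dpu eta (z, u))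
  (dpu (dpu eta) (z, u)) (dpz (tidx n) eta (z, u)) (ttw (z, u)) (X1w (z, u))
  (Xauw (z, u)) (Xbuw (z, u)) (X2w (z, u)) (Xuw (z, u)) (Xuuw (z, u)) (Xtw (z, u))
  (s 0) (fun a b => Q a b) P sQ' (erefl P).
refine (etrans _ red).
congr (_ + _ - _).
- apply: eq_bigr => a _; apply: eq_bigr => b _; rewrite jet_block_xx.
  congr (_ + _ * _); rewrite (prol2E oOm sxi seta) //.
  congr (_ - _ - _).
  + by rewrite /tot2 /tot1 !pt_xidx jet_block_xx.
  + rewrite big_tx tot1tau tot2tau !mulr0 !add0r; apply: eq_bigr => c _.
    by rewrite /tot2 /tot1 !pt_xidx !jet_block_xx.
  + rewrite big_tx tot1tau mulr0 add0r; apply: eq_bigr => c _.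
    by rewrite /tot1 !pt_xidx jet_block_xx.
- apply: eq_bigr => b _; rewrite pt_xidx (prol1E sxi seta) //.
  congr (_ + _ * (_ - _)); first by rewrite /tot1 pt_xidx.
  rewrite big_tx tot1tau mulr0 add0r; apply: eq_bigr => c _.
  by rewrite /tot1 !pt_xidx.
- rewrite (prol1E sxi seta) // big_tx /tot1 !pt_tidx tu mulr0 addr0.
  congr (_ - (_ + _)); by apply: eq_bigr => c _; rewrite pt_xidx.
Qed.

Definition metric_eq (a b : 'I_n) w : R :=
  dGw w a b - \sum_c (Gw w c b * X1w w c a + Gw w a c * X1w w c b) + ttw w * Gw w a b.

Definition drift_eq (c : 'I_n) w : R :=
  2 * (\sum_a Gw w a c * hbuw w a) - \sum_a \sum_b Gw w a b * X2w w a b c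
  + dEw w c - \sum_b Ew w b * X1w w b c + Xtw w c + ttw w * Ew w c.

Definition determining_eqs w : Prop :=
  [/\ dpu tau w = 0 /\ (forall a, dpz (xidx a) tau w = 0),
      forall c, dpu (chi c) w = 0,
      dpu (dpu eta) w = 0,
      forall a b, metric_eq a b w = 0
    & (forall c, drift_eq c w = 0) /\ cst_eq w = 0].

Lemma s1_partE w s : Om w -> s1_part w s = \sum_c s c * drift_eq c w.
Proof.
move=> Ow; apply: red_s1E => [a b|a]; first exact: (ginv_sym hg a b (OmU Ow)).
exact: (schwarz _ _ oOm seta Ow).
Qed.

Lemma dchi_u0 w v : Om w -> (forall w, Om w -> forall c, dpu (chi c) w = 0) ->
  forall c, 'D_v (dpu (chi c)) w = 0.
Proof.
move=> Ow X0 c; apply: ddirE; apply: (ddir_eq_on oOm _ Ow (ddir_cst _ _ 0)).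
by move=> w' Ow'; rewrite X0.
Qed.

Lemma s3_part_eq0 w s : Om w -> (forall w, Om w -> forall c, dpu (chi c) w = 0) ->
  s3_part w s = 0.
Proof.
move=> Ow X0; rewrite /s3_part /red_s3 sum3_eq0 ?oppr0 // => a b c.
by rewrite [dpu (dpu _) w](dchi_u0 _ Ow X0) !mulr0.
Qed.

Lemma s2_partE w s : Om w -> (forall w, Om w -> forall c, dpu (chi c) w = 0) ->
  s2_part w s = \sum_a \sum_b Gw w a b * (s a * s b * dpu (dpu eta) w).
Proof.
move=> Ow X0; rewrite /s2_part /red_s2 sum3_eq0 ?subr0 // => a b c.
have e (d : 'I_n) : dpz (xidx d) (dpu (chi c)) w = 0 by exact: (dchi_u0 _ Ow X0).
have e' (d : 'I_n) : dpu (dpz (xidx d) (chi c)) w = 0.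
  by apply: etrans (schwarz _ _ oOm (sxi (xidx c)) Ow) _; exact: e.
by rewrite e e' !mulr0 addr0 !mulr0.
Qed.

(** Symmetric [Q] detect only the symmetric part of their coefficient; this lemma makes that part
    the whole coefficient. *)
Lemma metric_eq_sym a b w : Om w -> metric_eq a b w = metric_eq b a w.
Proof.
move=> Ow; have Ux := OmU Ow; have gs a' b' := ginv_sym hg a' b' Ux.
rewrite /metric_eq (gs a b); congr (_ - _ + _).
  by apply: (derive_eq_on _ oU) Ux => y Uy; exact: (ginv_sym hg a b Uy).
by apply: eq_bigr => c _; rewrite (gs c b) (gs a c) addrC.
Qed.

Lemma Q_partE w Q : (forall a b, Q b a = Q a b) ->
  Q_part w Q = \sum_a \sum_b Q a b * metric_eq a b w.
Proof. exact: red_QE. Qed.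

Lemma determining_symmetry :
  (forall w, Om w -> determining_eqs w) -> lie_point_symmetry Om (evol_eq g C) xi eta.
Proof.
move=> det z u p q Ow /jet_blockP[d [r [Q [sQ ->]]]].
have tau0 w : Om w -> dpu tau w = 0 /\ forall a, dpz (xidx a) tau w = 0.
  by move=> /det[].
have X0 w : Om w -> forall c, dpu (chi c) w = 0 by move=> /det[].
have Ux := OmU Ow; have [tu ta] := tau0 _ Ow.
rewrite -{1 2}(ptK p) (evol_eqE C oU hg) // pt_tidx => ev.
(* On the equation, u_t is exactly the value that [prolong_reduced] inserts. *)
have ept : p 0 (tidx n) = \sum_a \sum_b Gw (z, u) a b * Q a b
    + \sum_b Ew (z, u) b * xpart p 0 b.
  apply/esym/eqP; rewrite -subr_eq0; apply/eqP; apply: etrans ev.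
  congr (_ + _ - _).
    by do 2!(apply: eq_bigr => ? _); rewrite jet_block_xx.
  by apply: eq_bigr => ? _; rewrite pt_xidx.
rewrite ept (prolong_evol_mixed oU hg sC oOm OmU sxi seta) //.
rewrite [X in _ - X = _]sum2_eq0 ?subr0; last first.
  by move=> a b; rewrite /tot1 !ta tu !mulr0 addr0 mulr0 mulr0 addr0 mulr0.
rewrite prolong_reduced //.
have [_ _ huu hm [hd hc]] := det _ Ow.
rewrite hc s1_partE // s2_partE // s3_part_eq0 // Q_partE; last first.
  by move=> a b; rewrite -{1}sQ mxE.
rewrite big1; last by move=> c _; rewrite hd mulr0.
rewrite sum2_eq0; last by move=> a b; rewrite huu !mulr0.
rewrite sum2_eq0; last by move=> a b; rewrite hm mulr0.
rewrite /sQ_part /red_sQ sum3_eq0 ?oppr0 ?addr0 // => a b c.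
by rewrite X0 // !mulr0.
Qed.

Hypothesis n_gt0 : (0 < n)%N.

(** Setting s or Q to zero isolates the constant part, the Q part and the part in s alone, and hence
    the sQ part. The last gives xi_u = 0 and so removes the cubic terms; parity in s splits what
    remains. *)
Lemma symmetry_determining :
  lie_point_symmetry Om (evol_eq g C) xi eta -> forall w, Om w -> determining_eqs w.
Proof.
move=> sym.
have tau0 := symmetry_tau oU hg sC oOm OmU sxi seta n_gt0 sym.
have zr : (0 : 'rV[R]_n) 0 = (fun=> 0) by apply/funext => i; rewrite mxE.
have zm : (fun a b => (0 : 'M[R]_n) a b) = (fun _ _ => 0).
  by apply/funext => a; apply/funext => b; rewrite mxE.
have s10 w : s1_part w (fun=> 0) = 0.
  have := red_s1_opp (Gw w) (Ew w) (dEw w) (hauw w) (hbuw w) (ttw w) (X1w w) (X2w w)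
    (Xtw w) (fun=> 0).
  by rewrite oppr0 -/(s1_part w _); move: (s1_part _ _) => k; lra.
have T w (s : 'rV[R]_n) (Q : 'M[R]_n) : Om w -> Q^T = Q ->
    cst_eq w + s1_part w (s 0) + s2_part w (s 0) + s3_part w (s 0)
    + Q_part w (fun a b => Q a b) + sQ_part w (s 0) (fun a b => Q a b) = 0.
  case: w => z u Ow sQ; rewrite -prolong_reduced //.
  exact: (sym _ _ _ _ Ow (jet_block_sym 0 0 sQ) (evol_eq_jet C oU hg OmU s 0 0 Q Ow)).
have c0 w : Om w -> cst_eq w = 0.
  move=> Ow; have := T w 0 0 Ow (trmx0 _ _ _).
  rewrite zr zm s10 /s2_part red_s2_0 /s3_part red_s3_0 /Q_part red_Q_0.
  by rewrite /sQ_part red_sQ_s0 !addr0.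
have Q0 w (Q : 'M[R]_n) : Om w -> Q^T = Q -> Q_part w (fun a b => Q a b) = 0.
  move=> Ow sQ; have := T w 0 Q Ow sQ.
  rewrite zr s10 /s2_part red_s2_0 /s3_part red_s3_0.
  by rewrite /sQ_part red_sQ_s0 c0 // !addr0 add0r.
have s0 w (s : 'rV[R]_n) : Om w ->
    s1_part w (s 0) + s2_part w (s 0) + s3_part w (s 0) = 0.
  move=> Ow; have := T w s 0 Ow (trmx0 _ _ _).
  by rewrite zm /Q_part red_Q_0 /sQ_part red_sQ_Q0 c0 // !addr0 add0r.
have sQ0 w (s : 'rV[R]_n) (Q : 'M[R]_n) : Om w -> Q^T = Q ->
    sQ_part w (s 0) (fun a b => Q a b) = 0.
  move=> Ow sQ; have := T w s Q Ow sQ.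
  by rewrite c0 // add0r s0 // Q0 // !add0r.
have X0 w : Om w -> forall c, dpu (chi c) w = 0.
  move=> Ow; apply: (ginv_contract_eq0 hg (OmU Ow)) => r.
  (* For Q the identity, the sQ part is minus the contraction treated by [ginv_contract_eq0]. *)
  have := sQ0 w r 1%:M Ow (trmx1 _ _).
  rewrite /sQ_part /red_sQ => /eqP; rewrite oppr_eq0 => /eqP e.
  apply: etrans e; apply: eq_bigr => a _; apply: eq_bigr => b _.
  rewrite -mulr_sumr; congr (_ * _).
  transitivity (\sum_c ((b == c)%:R * (r 0 a * dpu (chi c) w)
                        + (a == c)%:R * (r 0 b * dpu (chi c) w))).
    rewrite big_split /= (bigD1 b) //= eqxx mul1r big1 ?addr0; last first.
      by move=> c cb; rewrite eq_sym (negbTE cb) mul0r.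
    rewrite (bigD1 a) //= eqxx mul1r big1 ?addr0; first exact: addrC.
    by move=> c ca; rewrite eq_sym (negbTE ca) mul0r.
  have aux (x y p q k : R) : x * (p * k) + y * (q * k) = (x * p + y * q) * k by ring.
  by apply: eq_bigr => c _; rewrite !mxE; exact: aux.
have s3 w s : Om w -> s3_part w s = 0 by move=> Ow; exact: s3_part_eq0.
have s12 w (s : 'rV[R]_n) : Om w -> s1_part w (s 0) = 0 /\ s2_part w (s 0) = 0.
  move=> Ow; have e1 := s0 w s Ow; have e2 := s0 w (- s) Ow.
  have en : (- s) 0 = (fun a => - s 0 a) by apply/funext => a; rewrite mxE.
  move: e1 e2; rewrite en !s3 // {2}/s1_part red_s1_opp -/(s1_part w (s 0)).
  rewrite {2}/s2_part red_s2_opp -/(s2_part w (s 0)).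
  by move: (s1_part _ _) (s2_part _ _) => k l; lra.
have huu w : Om w -> dpu (dpu eta) w = 0.
  move=> Ow; pose i0 := Ordinal n_gt0.
  pose s : 'rV[R]_n := const_mx 1.
  suff h0 : forall r : 'rV[R]_n, \sum_a \sum_b Gw w a b *
      (r 0 b * (s 0 a * dpu (dpu eta) w) + r 0 a * (s 0 b * dpu (dpu eta) w)) = 0.
    have := ginv_contract_eq0 hg (s := fun a => s 0 a * dpu (dpu eta) w) (OmU Ow) h0 i0.
    by rewrite mxE mul1r.
  move=> r.
  have e (k : 'rV[R]_n) : \sum_a \sum_b Gw w a b * (k 0 a * k 0 b * dpu (dpu eta) w) = 0.
    by rewrite -s2_partE //; case: (s12 w k Ow).
  (* Polarisation turns the vanishing quadratic form into the bilinear expression in [r] and [s]. *)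
  transitivity (\sum_a \sum_b Gw w a b * ((r + s) 0 a * (r + s) 0 b * dpu (dpu eta) w)
    - \sum_a \sum_b Gw w a b * (r 0 a * r 0 b * dpu (dpu eta) w)
    - \sum_a \sum_b Gw w a b * (s 0 a * s 0 b * dpu (dpu eta) w)); last by rewrite !e !subr0.
  rewrite -!sumrB; apply: eq_bigr => a _; rewrite -!sumrB; apply: eq_bigr => b _.
  have aux (G rb sa ra sb k : R) : G * (rb * (sa * k) + ra * (sb * k))
    = G * ((ra + sa) * (rb + sb) * k) - G * (ra * rb * k) - G * (sa * sb * k) by ring.
  rewrite [(r + s) 0 a]mxE [(r + s) 0 b]mxE; exact: aux.
move=> w Ow; split; first exact: tau0.
- exact: X0.
- exact: huu.
- move=> i j.
  (* The sum of the two elementary matrices is symmetric, hence admissible, and picks out the (i, j)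
     and (j, i) coefficients. *)
  have := Q0 w (delta_mx i j + delta_mx j i) Ow.
  rewrite linearD /= !trmx_delta addrC => /(_ erefl).
  rewrite Q_partE; last by move=> a b; rewrite !mxE addrC (andbC (b == _)) (andbC (b == _)).
  have E (i' j' : 'I_n) : \sum_a \sum_b delta_mx i' j' a b * metric_eq a b w
      = metric_eq i' j' w.
    rewrite (bigD1 i') //= (bigD1 j') //= mxE !eqxx mul1r !big1 ?addr0 //.
      move=> a ai; rewrite big1 // => b _; by rewrite mxE (negbTE ai) mul0r.
    by move=> b bj; rewrite mxE (negbTE bj) andbF mul0r.
  have -> : metric_eq i j w = (metric_eq i j w + metric_eq j i w) / 2.
    by rewrite (metric_eq_sym j i) //; move: (metric_eq _ _ _) => k; field.
  move=> h; apply: etrans (_ : 0 / 2 = 0); last by rewrite mul0r.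
  congr (_ / _); rewrite -[in RHS]h -!E -big_split; apply: eq_bigr => a _.
  rewrite -big_split; apply: eq_bigr => b _ /=.
  by rewrite -mulrDl; congr (_ * _); rewrite !mxE addrC.
- split; last exact: c0.
  move=> c; have [+ _] := s12 w (basis_vec c) Ow; rewrite s1_partE //.
  rewrite (bigD1 c) //= mxE !eqxx mul1r big1 ?addr0 // => a ac.
  by rewrite mxE (negbTE ac) andbF mul0r.
Qed.

End DeterminingEquations.

(** * Restriction to constant t or u *)

Section Slices.
Variables (R : realType) (n : nat).
Local Notation N := (1 + n)%N.
Implicit Types (F : jet0 R N -> R) (f : 'rV[R]_N -> R).

Lemma basis_xt (a : 'I_n) : basis_vec (xidx a) 0 (tidx n) = 0 :> R.
Proof. by rewrite /basis_vec mxE eq_lrshift. Qed.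

Lemma basis_tt : basis_vec (tidx n) 0 (tidx n) = 1 :> R.
Proof. by rewrite /basis_vec mxE !eqxx. Qed.

Lemma basis_tx (a : 'I_n) : basis_vec (tidx n) 0 (xidx a) = 0 :> R.
Proof. by rewrite /basis_vec mxE eq_rlshift. Qed.

Lemma basis_xx (a b : 'I_n) : basis_vec (xidx a) 0 (xidx b) = basis_vec a 0 b :> R.
Proof. by rewrite /basis_vec !mxE (inj_eq (@rshift_inj _ _)). Qed.

Lemma row_txP (v w : 'rV[R]_N) :
  v 0 (tidx n) = w 0 (tidx n) -> (forall a, v 0 (xidx a) = w 0 (xidx a)) -> v = w.
Proof.
by move=> et ex; apply/rowP => i; case: (split_ordP i) => j ->; rewrite ?ord1.
Qed.

Lemma addZrowE m (h : R) (v w : 'rV[R]_m) i : (h *: v + w) 0 i = h * v 0 i + w 0 i.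
Proof. by rewrite !mxE. Qed.

Lemma pt_affine_x (t h : R) (a : 'I_n) (x : 'rV[R]_n) :
  pt t (h *: basis_vec a + x) = h *: basis_vec (xidx a) + pt t x.
Proof.
apply: row_txP => [|b]; rewrite addZrowE.
  by rewrite !pt_tidx basis_xt mulr0 add0r.
by rewrite !pt_xidx basis_xx addZrowE.
Qed.

Lemma pt_affine_t (t h : R) (x : 'rV[R]_n) :
  pt (h *: (1 : R) + t) x = h *: basis_vec (tidx n) + pt t x.
Proof.
apply: row_txP => [|b]; rewrite addZrowE.
  by rewrite !pt_tidx basis_tt [h *: _]mulr1 mulr1.
by rewrite !pt_xidx basis_tx mulr0 add0r.
Qed.

Lemma pt_sum t (x : 'rV[R]_n) :
  pt t x = t *: basis_vec (tidx n) + \sum_a x 0 a *: basis_vec (xidx a).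
Proof.
apply: row_txP => [|b]; rewrite addZrowE summxE.
  rewrite pt_tidx basis_tt mulr1 big1 ?addr0 // => a _.
  by rewrite [LHS]mxE basis_xt mulr0.
rewrite pt_xidx basis_tx mulr0 add0r (bigD1 b) //= big1 ?addr0.
  by rewrite [RHS]mxE basis_xx mxE !eqxx mulr1.
by move=> a ab; rewrite [LHS]mxE basis_xx mxE eq_sym (negbTE ab) andbF mulr0.
Qed.

Lemma partial_dpz F t u a :
  partial a (fun y => F (pt t y, u)) = (fun y => dpz (xidx a) F (pt t y, u)).
Proof.
apply/funext => x; apply: (@derive_affine _ _ _ (fun y => (pt t y, u) : jet0 R N)) => h.
by rewrite pt_affine_x; congr pair; rewrite /= scaler0 add0r.
Qed.

Lemma derive_t_dpz F t x u : 'D_1 (fun s => F (pt s x, u)) t = dpz (tidx n) F (pt t x, u).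
Proof.
apply: (@derive_affine _ _ _ (fun s => (pt s x, u) : jet0 R N)) => h.
by rewrite pt_affine_t; congr pair; rewrite /= scaler0 add0r.
Qed.

Lemma pt_differentiable_x t (x : 'rV[R]_n) : differentiable (pt t) x.
Proof.
have -> : pt t = cst (t *: basis_vec (tidx n))
    + \sum_a (fun y : 'rV[R]_n => y 0 a *: basis_vec (xidx a)).
  by apply/funext => y; rewrite pt_sum !fctE fct_sumE.
apply: differentiableD; first exact: differentiable_cst.
apply: differentiable_sum => a; apply: differentiableZl.
exact: differentiable_coord.
Qed.

Lemma pt_differentiable_t t (x : 'rV[R]_n) : differentiable (fun s : R => pt s x) t.
Proof.
have -> : (fun s : R => pt s x) = (fun s : R => s *: basis_vec (tidx n))
    + cst (\sum_a x 0 a *: basis_vec (xidx a)).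
  by apply/funext => y; rewrite pt_sum.
apply: differentiableD; last exact: differentiable_cst.
by apply: differentiableZl; exact: ex_diff.
Qed.

Lemma pt_affine_row t (h : R) (v x : 'rV[R]_n) :
  pt t (h *: v + x) = h *: pt 0 v + pt t x.
Proof.
apply: row_txP => [|b]; rewrite addZrowE.
  by rewrite !pt_tidx mulr0 add0r.
by rewrite !pt_xidx addZrowE.
Qed.

Variables (U : set 'rV[R]_n) (J W : set R).
Hypotheses (oU : open U) (oJ : open J) (oW : open W).
Local Notation M := (spacetime J U).

Lemma spacetime_pt t x : M (pt t x) <-> J t /\ U x.
Proof. by rewrite /spacetime /= pt_tidx xpart_pt. Qed.

Lemma spacetime_open : open M.
Proof.
have -> : M = (fun z : 'rV[R]_N => z 0 (tidx n)) @^-1` J `&` (@xpart R n) @^-1` U by [].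
apply: openI; last exact: open_preimage (@xpart_continuous R n) oU.
apply: open_preimage => // z; apply: differentiable_continuous.
exact: differentiable_coord.
Qed.

Lemma spacetimeW_open : open (M `*` W).
Proof.
apply: (@openI _ (fst @^-1` M) (snd @^-1` W)); apply: open_preimage => //.
- exact: fst_continuous.
- exact: spacetime_open.
- exact: snd_continuous.
Qed.

Lemma smooth_slice_u F u : W u -> smooth_on (M `*` W) F ->
  smooth_on M (fun z => F (z, u)).
Proof.
move=> Wu; apply: (@smooth_affine _ _ _ _ _ (fun z => (z, u) : jet0 R N)
  (fun v => (v, 0))); first exact: spacetime_open.
- by move=> z _; apply: differentiable_pair; [exact: ex_diff|exact: differentiable_cst].
- by move=> z v h; congr pair; rewrite /= scaler0 add0r.
- by move=> z Mz; split.
Qed.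

Lemma smooth_slice_x f t : J t -> smooth_on M f -> smooth_on U (fun x => f (pt t x)).
Proof.
move=> Jt; apply: (@smooth_affine _ _ _ _ _ (pt t) (pt 0)) => //.
- by move=> x _; exact: pt_differentiable_x.
- by move=> x v h; rewrite pt_affine_row.
- by move=> x Ux; apply/spacetime_pt.
Qed.

Lemma smooth_slice_t f x : U x -> smooth_on M f -> smooth_on J (fun t => f (pt t x)).
Proof.
move=> Ux; apply: (@smooth_affine _ R _ _ _ (fun s => pt s x)
   (fun v : R => v *: basis_vec (tidx n))) => //.
- by move=> t _; exact: pt_differentiable_t.
- move=> t v h; rewrite !pt_sum addrA; congr (_ + _).
  by rewrite scalerDl scalerA.
- by move=> t Jt; apply/spacetime_pt.
Qed.

End Slices.

(** * Determining equations as tensor equations on slices *)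

Section EvolutionOperator.
Variables (R : realType) (n : nat).
Local Notation N := (1 + n)%N.
Variables (U : set 'rV[R]_n) (J W : set R).
Hypotheses (oU : open U) (oJ : open J) (oW : open W).
Variables (g : 'rV[R]_n -> 'M[R]_n) (C : 'rV[R]_n -> 'rV[R]_n).
Hypotheses (hg : smooth_metric U g) (sC : smooth_field U C).
Local Notation M := (spacetime J U).

(** Jet derivatives and slice derivatives carry their two indices in opposite order; symmetry of G
    absorbs this without exchanging derivatives. *)
Lemma sum2_symP (G P Q : 'I_n -> 'I_n -> R) :
  (forall a b, G a b = G b a) -> (forall a b, P a b = Q a b) ->
  \sum_a \sum_b G a b * P b a = \sum_a \sum_b G a b * Q a b.
Proof.
move=> sG PQ; rewrite exchange_big; apply: eq_bigr => a _; apply: eq_bigr => b _ /=.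
by rewrite sG PQ.
Qed.

Lemma derive_lin (E : normedModType R) (D : set E) (F A B : E -> R) (k c : R) :
  open D -> smooth_on D A -> smooth_on D B ->
  (forall x, D x -> F x = k * A x + B x + c) ->
  forall v x, D x -> 'D_v F x = k * 'D_v A x + 'D_v B x.
Proof.
move=> oD sA sB eF v x Dx; apply: ddirE.
apply: (ddir_eq_on (f := fun y => k * A y + B y + c) oD _ Dx).
  by move=> y Dy; rewrite eF.
rewrite -[X in ddir _ _ _ X]addr0; apply: ddirD; last exact: ddir_cst.
apply: ddirD; last exact: (smooth_ddir v sB Dx).
exact/ddirMl/(smooth_ddir v sA Dx).
Qed.

Lemma evol_opE f t x : smooth_on U (fun y => f (pt t y)) -> U x ->
  evol_op g C f t x
  = \sum_a \sum_b ginv g x a b * partial a (partial b (fun y => f (pt t y))) x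
    + \sum_b drift g C b x * partial b (fun y => f (pt t y)) x
    - 'D_1 (fun s => f (pt s x)) t.
Proof.
move=> sf Ux; rewrite /evol_op (laplacianE oU hg sf Ux) derive1E; congr (_ - _).
rewrite -addrA -sumrB; congr (_ + _); apply: eq_bigr => b _.
by rewrite /drift mulrBl.
Qed.

(** The operator has no zeroth-order term and annihilates the constant [c]; this is why c_2 u may be
    added to eta. *)
Lemma evol_op_lin (f a b : 'rV[R]_N -> R) (k c : R) t x :
  smooth_on M a -> smooth_on M b ->
  (forall z, M z -> f z = k * a z + b z + c) -> J t -> U x ->
  evol_op g C f t x = k * evol_op g C a t x + evol_op g C b t x.
Proof.
move=> sa sb ef Jt Ux.
have sax := smooth_slice_x oU Jt sa; have sbx := smooth_slice_x oU Jt sb.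
have efx y : U y -> f (pt t y) = k * a (pt t y) + b (pt t y) + c.
  by move=> Uy; apply: ef; apply/spacetime_pt.
have sf : smooth_on U (fun y => f (pt t y)).
  apply: (smooth_eq_on (f := fun y => k * a (pt t y) + b (pt t y) + c) oU).
    by move=> y /efx.
  apply: smoothD => //; last exact: smooth_cst.
  by apply: smoothD => //; apply: smoothM => //; exact: smooth_cst.
have e1 := derive_lin oU sax sbx efx.
have e2 v w y : U y -> 'D_v ('D_w (fun y => f (pt t y))) y
   = k * 'D_v ('D_w (fun y => a (pt t y))) y + 'D_v ('D_w (fun y => b (pt t y))) y.
  apply: (@derive_lin _ U _ _ _ k 0 oU (smooth_derive w sax) (smooth_derive w sbx)).
  by move=> y' Uy'; rewrite addr0; exact: e1.
have et : 'D_1 (fun s => f (pt s x)) t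
   = k * 'D_1 (fun s => a (pt s x)) t + 'D_1 (fun s => b (pt s x)) t.
  apply: (@derive_lin _ J _ _ _ k c oJ (smooth_slice_t oJ Ux sa) (smooth_slice_t oJ Ux sb)) Jt.
  by move=> s Js; apply: ef; apply/spacetime_pt.
have aux (G p q r : R) : p = k * q + r -> G * p = k * (G * q) + G * r.
  by move=> ->; ring.
have f2 : \sum_i \sum_j ginv g x i j * partial i (partial j (fun y => f (pt t y))) x
  = k * (\sum_i \sum_j ginv g x i j * partial i (partial j (fun y => a (pt t y))) x)
    + \sum_i \sum_j ginv g x i j * partial i (partial j (fun y => b (pt t y))) x.
  rewrite mulr_sumr -big_split; apply: eq_bigr => i _ /=.
  rewrite mulr_sumr -big_split; apply: eq_bigr => j _ /=.
  exact: aux (e2 (basis_vec i) (basis_vec j) x Ux).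
have f1 : \sum_j drift g C j x * partial j (fun y => f (pt t y)) x
  = k * (\sum_j drift g C j x * partial j (fun y => a (pt t y)) x)
    + \sum_j drift g C j x * partial j (fun y => b (pt t y)) x.
  rewrite mulr_sumr -big_split; apply: eq_bigr => j _ /=.
  exact: aux (e1 (basis_vec j) x Ux).
rewrite (evol_opE sf Ux) (evol_opE sax Ux) (evol_opE sbx Ux).
have aux3 (p q r pa qa ra pb qb rb : R) : p = k * pa + pb -> q = k * qa + qb ->
  r = k * ra + rb -> p + q - r = k * (pa + qa - ra) + (pb + qb - rb).
  by move=> -> -> ->; ring.
exact: aux3 f2 f1 et.
Qed.

Variables (xi : jet0 R N -> 'rV[R]_N) (eta : jet0 R N -> R).
Hypotheses (sxi : forall i, smooth_on (M `*` W) (fun w => xi w 0 i)).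
Hypotheses (seta : smooth_on (M `*` W) eta).
Local Notation tau := (fun w => xi w 0 (tidx n)).
Local Notation chi c := (fun w => xi w 0 (xidx c)).

Lemma cst_evol t x u : J t -> U x -> W u ->
  cst_eq g C eta (pt t x, u) = evol_op g C (fun z => eta (z, u)) t x.
Proof.
move=> Jt Ux Wu.
have sf : smooth_on U (fun y => eta (pt t y, u)).
  exact: (smooth_slice_x oU Jt (smooth_slice_u oU oJ Wu seta)).
apply: etrans (esym (@evol_opE (fun z => eta (z, u)) t x sf Ux)).
have e1 : \sum_a \sum_b ginv g x a b * dpz (xidx b) (dpz (xidx a) eta) (pt t x, u)
   = \sum_a \sum_b ginv g x a b * partial a (partial b (fun y => eta (pt t y, u))) x.
  apply: (sum2_symP (P := fun b a => dpz (xidx b) (dpz (xidx a) eta) (pt t x, u))).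
    by move=> a b; exact: (ginv_sym hg a b Ux).
  by move=> a b; rewrite (partial_dpz eta) (partial_dpz (dpz (xidx b) eta)).
have e2 : \sum_b drift g C b x * dpz (xidx b) eta (pt t x, u)
   = \sum_b drift g C b x * partial b (fun y => eta (pt t y, u)) x.
  by apply: eq_bigr => b _; rewrite (partial_dpz eta).
have e3 := esym (derive_t_dpz eta t x u).
rewrite /cst_eq /red_s0 /= xpart_pt.
have aux (p q r p' q' r' : R) : p = p' -> q = q' -> r = r' -> p + q - r = p' + q' - r'.
  by move=> -> -> ->.
exact: aux e1 e2 e3.
Qed.

Definition slice t u : 'rV[R]_n -> 'rV[R]_n := fun y => xpart (xi (pt t y, u)).
Definition slice_dt t u : 'rV[R]_n -> 'rV[R]_n :=
  fun y => \row_c dpz (tidx n) (chi c) (pt t y, u).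

Lemma sliceE t u c : (fun y => slice t u y 0 c) = (fun y => (chi c) (pt t y, u)).
Proof. by apply/funext => y; rewrite mxE. Qed.

Lemma partial_slice t u a c : partial a (fun y => slice t u y 0 c)
  = (fun y => dpz (xidx a) (chi c) (pt t y, u)).
Proof. exact: etrans (congr1 (partial a) (sliceE t u c)) (partial_dpz (chi c) t u a). Qed.

Lemma slice_smooth t u : J t -> W u -> smooth_field U (slice t u).
Proof.
move=> Jt Wu c; rewrite sliceE.
exact: (smooth_slice_x oU Jt (smooth_slice_u oU oJ Wu (sxi (xidx c)))).
Qed.

Lemma metric_eq_lie t x u : J t -> U x -> W u ->
  (forall a b, metric_eq g xi a b (pt t x, u) = 0) <->
  (forall a b, lie_metric (slice t u) g a b x
               = dpz (tidx n) tau (pt t x, u) * g x a b).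
Proof.
move=> Jt Ux Wu; set k := dpz _ _ _.
have e a b : metric_eq g xi a b (pt t x, u)
    = lie_ginv g (slice t u) a b x + k * ginv g x a b.
  rewrite /metric_eq /= xpart_pt; congr (_ + _).
  rewrite derive_partial; last exact: smooth_differentiable (ginv_smooth oU hg a b) Ux.
  rewrite -sumrB /lie_ginv; apply: eq_bigr => c _.
  by rewrite opprD addrA !partial_slice [slice t u x]/slice.
apply: iff_trans (iff_sym (lie_metric_ginv oU hg (slice t u) k Ux)).
split=> h a b; first by have := h a b; rewrite e => /eqP; rewrite addr_eq0 -mulNr => /eqP.
by rewrite e h mulNr addNr.
Qed.

(** After [drift] is split into [gam] and C, [lie_gam] cancels the [gam] terms and
    [lie_covector_lower] lowers the index. The homothety equation is assumed on all of U because
    [lie_gam] differentiates it; the equivalence is pointwise. *)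
Lemma drift_eq_lie t u k : J t -> W u ->
  (forall x, U x -> dpz (tidx n) tau (pt t x, u) = k) ->
  (forall x, U x -> forall a b, lie_metric (slice t u) g a b x = k * g x a b) ->
  forall x, U x ->
  (forall c, drift_eq g C xi eta c (pt t x, u) = 0) <->
  (forall al, lie_covector (slice t u) (lower g C) al x - lower g (slice_dt t u) al x
     - 2 * partial al (fun y => dpu eta (pt t y, u)) x = 0).
Proof.
move=> Jt Wu hk hL x Ux.
apply: iff_sym; apply: iff_trans (lie_covector_lower hg (slice_dt t u)
  (fun al => partial al (fun y => dpu eta (pt t y, u)) x) Ux sC (hL x Ux)) _.
suff e c : drift_eq g C xi eta c (pt t x, u) =
   - (k * C x 0 c + \sum_d (slice t u x 0 d * partial d (fun y => C y 0 c) x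
       - C x 0 d * partial d (fun y => slice t u y 0 c) x) - slice_dt t u x 0 c
       - 2 * \sum_a ginv g x c a * partial a (fun y => dpu eta (pt t y, u)) x).
  split=> h c; first by rewrite e h oppr0.
  by apply: oppr_inj; rewrite -e h oppr0.
have lg := lie_gam oU hg (slice_smooth Jt Wu) hL c Ux.
have eX2 : \sum_a \sum_b ginv g x a b
    * dpz (xidx b) (dpz (xidx a) (chi c)) (pt t x, u)
   = \sum_a \sum_b ginv g x a b * partial a (partial b (fun y => slice t u y 0 c)) x.
  apply: (sum2_symP (P := fun b a => dpz (xidx b) (dpz (xidx a) (chi c)) (pt t x, u))).
    by move=> a b; exact: (ginv_sym hg a b Ux).
  move=> a b; rewrite partial_slice.
  by rewrite (partial_dpz (dpz (xidx b) (chi c))).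
have eEX : \sum_b drift g C b x * dpz (xidx b) (chi c) (pt t x, u)
   = \sum_b gam g b x * partial b (fun y => slice t u y 0 c) x
     - \sum_b C x 0 b * partial b (fun y => slice t u y 0 c) x.
  rewrite -sumrB; apply: eq_bigr => b _.
  by rewrite partial_slice /drift mulrBl.
have edE : 'D_(xpart (xi (pt t x, u))) (drift g C c) x
   = \sum_d slice t u x 0 d * partial d (gam g c) x
     - \sum_d slice t u x 0 d * partial d (fun y => C y 0 c) x.
  rewrite derive_partial; last exact: smooth_differentiable (drift_smooth oU hg sC c) Ux.
  rewrite -sumrB; apply: eq_bigr => d _; rewrite -mulrBr; congr (_ * _).
  apply: ddirE; apply: ddirB; first exact: (smooth_ddir _ (gam_smooth oU hg c) Ux).
  exact: (smooth_ddir _ (sC c) Ux).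
have eGw : \sum_a ginv g x a c * dpz (xidx a) (dpu eta) (pt t x, u)
   = \sum_a ginv g x c a * partial a (fun y => dpu eta (pt t y, u)) x.
  by apply: eq_bigr => a _; rewrite (ginv_sym hg a c Ux) (partial_dpz (dpu eta)).
have eXt : slice_dt t u x 0 c = dpz (tidx n) (chi c) (pt t x, u) by rewrite [LHS]mxE.
rewrite /drift_eq /= xpart_pt sumrB.
have aux (w w' X2 XX Xg XC EX GX CX dE Xt Xt' kk ga Cc E : R) :
  Xg - XX - GX = - k * ga -> X2 = XX -> EX = GX - CX -> dE = Xg - XC -> w = w' ->
  Xt' = Xt -> kk = k -> E = ga - Cc ->
  2 * w - X2 + dE - EX + Xt + kk * E = - (k * Cc + (XC - CX) - Xt' - 2 * w').
  move=> h -> -> -> -> -> -> ->; have -> : Xg = - k * ga + XX + GX by rewrite -h; ring.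
  by ring.
exact: aux lg eX2 eEX edE eGw eXt (hk x Ux) (erefl (drift g C c x)).
Qed.

End EvolutionOperator.

(** * Expansion in a basis of the homothetic algebra *)

Section Combinations.
Variables (R : realType) (n m : nat) (U : set 'rV[R]_n).
Variable Y : 'I_m -> 'rV[R]_n -> 'rV[R]_n.

(** Rows are added one at a time. Fewer than m evaluations annihilate some nonzero [k]; the field
    with coefficients [k] is nonzero by independence, so one of its components at some point
    supplies the next row. *)
Lemma independent_evaluations :
  (forall k : 'I_m -> R, (forall x, U x -> \sum_I k I *: Y I x = 0) -> forall I, k I = 0) ->
  exists p : 'I_m -> 'rV[R]_n * 'I_n, (forall j, U (p j).1) /\
    (\matrix_(j, I) Y I (p j).1 0 (p j).2) \in unitmx.
Proof.
move=> indep.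
suff H r : (r <= m)%N -> exists p : 'I_r -> 'rV[R]_n * 'I_n, (forall j, U (p j).1) /\
    row_free (\matrix_(j < r, I < m) Y I (p j).1 0 (p j).2).
  by have [p [Up fp]] := H m (leqnn m); exists p; split => //; rewrite -row_free_unit.
elim: r => [|r IH] rm.
  have p : 'I_0 -> 'rV[R]_n * 'I_n by case.
  exists p; split; first by case.
  by rewrite /row_free [X in \rank X]flatmx0 mxrank0.
have [p [Up fp]] := IH (ltnW rm); set A := \matrix_(_, _) _ in fp.
have [k kA k0] : exists2 k : 'rV[R]_m, k *m A^T = 0 & k != 0.
  have nz : kermx A^T != 0.
    rewrite -mxrank_eq0 mxrank_ker mxrank_tr subn_eq0 -ltnNge.
    by move/eqP: fp => ->.
  have /rowV0Pn[k] := nz; move=> /sub_kermxP kA k0; by exists k.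
have [x Ux [al xal]] : exists2 x, U x & exists al, (\sum_I k 0 I *: Y I x) 0 al != 0.
  apply: contrapT => no; move/eqP: k0; apply; apply/rowP => I; rewrite mxE.
  apply: (indep (fun I => k 0 I)) => x Ux; apply/rowP => al; rewrite [RHS]mxE.
  by apply/eqP/negPn/negP => h; apply: no; exists x => //; exists al.
rewrite -addn1.
pose p' (j : 'I_(r + 1)) := match fintype.split j with inl i => p i | inr _ => (x, al) end.
exists p'; split; first by move=> j; rewrite /p'; case: fintype.split.
pose b : 'rV[R]_m := \row_I Y I x 0 al.
have -> : \matrix_(j, I) Y I (p' j).1 0 (p' j).2 = col_mx A b.
  by apply/matrixP => j I; rewrite !mxE /p'; case: fintype.split => i; rewrite !mxE.
apply: inj_row_free => v; rewrite -[v]hsubmxK mul_row_col => e.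
(* Pairing the relation with [k] kills the old rows but not the new one, so the new coefficient is
   zero. *)
have v2 : rsubmx v = 0.
  have := congr1 (mulmx^~ k^T) e; rewrite mul0mx mulmxDl -!mulmxA.
  have -> : A *m k^T = 0 by apply: trmx_inj; rewrite trmx_mul trmxK kA trmx0.
  rewrite mulmx0 add0r => /matrixP /(_ 0 0); rewrite !mxE big_ord1.
  have -> : (b *m k^T) 0 0 = (\sum_I k 0 I *: Y I x) 0 al.
    rewrite mxE summxE; apply: eq_bigr => I _; rewrite [b 0 I]mxE [RHS]mxE.
    by rewrite mulrC; congr (_ * _); rewrite mxE.
  move=> /eqP; rewrite mulf_eq0 (negbTE xal) orbF => /eqP h.
  by apply/rowP => i; rewrite ord1 [RHS]mxE -h !mxE.
move: e; rewrite v2 mul0mx addr0 => e.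
by rewrite (row_free_inj fp (etrans e (esym (mul0mx _ _)))) row_mx0.
Qed.

Variable (g : 'rV[R]_n -> 'M[R]_n).
Hypothesis oU : open U.
Hypothesis sY : forall I, smooth_field U (Y I).
Variables (Z : 'rV[R]_n -> 'rV[R]_n) (k : 'I_m -> R).
Hypothesis ZE : forall x, U x -> Z x = \sum_I k I *: Y I x.

Lemma comb_coord x c : U x -> Z x 0 c = \sum_I k I * Y I x 0 c.
Proof. by move=> /ZE ->; rewrite summxE; apply: eq_bigr => I _; rewrite mxE. Qed.

Lemma comb_partial x a c : U x -> partial a (fun y => Z y 0 c) x
  = \sum_I k I * partial a (fun y => Y I y 0 c) x.
Proof.
move=> Ux; apply: ddirE.
apply: (ddir_eq_on (f := fun y => \sum_I k I * Y I y 0 c) oU _ Ux).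
  by move=> y /comb_coord ->.
by apply: ddir_sum => I _; apply/ddirMl/(smooth_ddir _ (sY I c) Ux).
Qed.

Lemma comb_lie_metric x a b : U x ->
  lie_metric Z g a b x = \sum_I k I * lie_metric (Y I) g a b x.
Proof.
move=> Ux; rewrite /lie_metric.
under [RHS]eq_bigr do rewrite mulr_sumr.
rewrite exchange_big; apply: eq_bigr => c _ /=.
rewrite (comb_coord c Ux) (comb_partial a c Ux) (comb_partial b c Ux).
rewrite mulr_suml !mulr_sumr -!big_split; apply: eq_bigr => I _ /=.
have aux (p q r s t e h : R) : p * q * r + s * (p * t) + e * (p * h)
  = p * (q * r + s * t + e * h) by ring.
exact: aux.
Qed.

Lemma comb_lie_covector w x a : U x ->
  lie_covector Z w a x = \sum_I k I * lie_covector (Y I) w a x.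
Proof.
move=> Ux; rewrite /lie_covector.
under [RHS]eq_bigr do rewrite mulr_sumr.
rewrite exchange_big; apply: eq_bigr => c _ /=.
rewrite (comb_coord c Ux) (comb_partial a c Ux).
rewrite mulr_suml !mulr_sumr -!big_split; apply: eq_bigr => I _ /=.
have aux (p q r s t : R) : p * q * r + s * (p * t) = p * (q * r + s * t) by ring.
exact: aux.
Qed.

Lemma comb_lower x a : U x -> lower g Z a x = \sum_I k I * lower g (Y I) a x.
Proof.
move=> Ux; rewrite /lower.
under [RHS]eq_bigr do rewrite mulr_sumr.
rewrite exchange_big; apply: eq_bigr => c _ /=.
rewrite (comb_coord c Ux) mulr_sumr; apply: eq_bigr => I _; ring.
Qed.

End Combinations.

Section Constancy.
Variables (R : realType).

Lemma interval_constant (J : set R) (f : R -> R) : open J -> is_interval J ->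
  (forall t, J t -> ddir t 1 f 0) -> forall s t, J s -> J t -> f s = f t.
Proof.
move=> oJ iJ df; apply: (connected_constant oJ (connected_open_interval iJ)).
  by move=> t /df[/derivable1_diffP].
move=> t v /df[/derivable1_diffP dt et].
by rewrite derive_1 // et mulr0.
Qed.

(** Openness of W provides a second value of u, and two values determine an affine function. *)
Lemma affine_eq0 (W : set R) (p q : R) : open W -> W !=set0 ->
  (forall u, W u -> u * p + q = 0) -> p = 0 /\ q = 0.
Proof.
move=> oW [u Wu] h.
have /nbhs_ballP[r /= r0 hr] : nbhs u W by exact: open_nbhs_nbhs.
have Wv : W (u + r / 2).
  apply: hr; rewrite -ball_normE /ball_ /= opprD addNKr normrN ger0_norm; first lra.
  by rewrite divr_ge0 ?ltW.
have e1 := h _ Wu; have e2 := h _ Wv.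
have /eqP : r * p = 0 by lra.
rewrite mulf_eq0 gt_eqF //= => /eqP p0; split => //.
by move: e1; rewrite p0 mulr0 add0r.
Qed.

Variable n : nat.
Local Notation N := (1 + n)%N.
Variables (U : set 'rV[R]_n) (J W : set R).
Hypotheses (oU : open U) (oJ : open J) (oW : open W).
Local Notation M := (spacetime J U).
Implicit Types (F : jet0 R N -> R).

Lemma ddir_slice_u F z u : smooth_on (M `*` W) F -> M z -> W u ->
  ddir u 1 (fun v => F (z, v)) (dpu F (z, u)).
Proof.
move=> sF Mz Wu; apply: (@ddir_affine _ R _ (fun v => (z, v) : jet0 R N) u 1 (0, 1) F).
  by move=> h; congr pair; rewrite /= scaler0 add0r.
have Ow : (M `*` W) (z, u) by [].
exact: (smooth_ddir (f := F) _ sF Ow).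
Qed.

Lemma ddir_slice_t F t x u : smooth_on (M `*` W) F -> J t -> U x -> W u ->
  ddir t 1 (fun s => F (pt s x, u)) (dpz (tidx n) F (pt t x, u)).
Proof.
move=> sF Jt Ux Wu.
apply: (@ddir_affine _ R _ (fun s => (pt s x, u) : jet0 R N) t 1 (basis_vec (tidx n), 0) F).
  by move=> h; rewrite pt_affine_t; congr pair; rewrite /= scaler0 add0r.
have Ow : (M `*` W) (pt t x, u) by split => //; apply/spacetime_pt.
exact: (smooth_ddir (f := F) _ sF Ow).
Qed.

Lemma constant_u F : is_interval W -> smooth_on (M `*` W) F ->
  (forall w, (M `*` W) w -> dpu F w = 0) ->
  forall z u v, M z -> W u -> W v -> F (z, u) = F (z, v).
Proof.
move=> iW sF F0 z u v Mz Wu Wv.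
apply: (interval_constant (f := fun v => F (z, v)) oW iW) => // v' Wv'.
by rewrite -(F0 (z, v')) //; exact: ddir_slice_u.
Qed.

Lemma constant_x F : connected U -> smooth_on (M `*` W) F ->
  (forall w, (M `*` W) w -> forall a, dpz (xidx a) F w = 0) ->
  forall t x y u, J t -> W u -> U x -> U y -> F (pt t x, u) = F (pt t y, u).
Proof.
move=> cU sF F0 t x y u Jt Wu Ux Uy.
have sf := smooth_slice_x oU Jt (smooth_slice_u oU oJ Wu sF).
apply: (connected_constant (f := fun y => F (pt t y, u)) oU cU) => //.
  by move=> x' Ux'; exact: smooth_differentiable sf Ux'.
move=> x' v Ux'; rewrite derive_partial; last exact: smooth_differentiable sf Ux'.
rewrite big1 // => a _; rewrite (partial_dpz F) F0 ?mulr0 //.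
by split => //; apply/spacetime_pt.
Qed.

End Constancy.

Section SliceForm.
Variables (R : realType) (n : nat).
Local Notation N := (1 + n)%N.
Variables (U : set 'rV[R]_n) (J W : set R).
Hypotheses (oU : open U) (oJ : open J) (oW : open W).
Variables (g : 'rV[R]_n -> 'M[R]_n) (C : 'rV[R]_n -> 'rV[R]_n).
Hypotheses (hg : smooth_metric U g) (sC : smooth_field U C).
Local Notation M := (spacetime J U).
Variables (m : nat) (Y : 'I_m -> 'rV[R]_n -> 'rV[R]_n) (psi : 'I_m -> R).
Hypothesis hY : forall I, homothetic U g (Y I) (psi I).
Variables (xi : jet0 R N -> 'rV[R]_N) (eta : jet0 R N -> R).
Hypotheses (sxi : forall i, smooth_on (M `*` W) (fun w => xi w 0 i)).
Hypotheses (seta : smooth_on (M `*` W) eta).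
Local Notation tau := (fun w => xi w 0 (tidx n)).
Local Notation chi c := (fun w => xi w 0 (xidx c)).

Lemma basis_smooth I : smooth_field U (Y I).
Proof. by case: (hY I). Qed.

Section Combination.
Variables (T : 'I_m -> R -> R) (u : R).
Hypotheses (sT : forall I, smooth_on J (T I)) (Wu : W u).
Hypothesis chiE : forall t x, J t -> U x -> forall c,
  (chi c) (pt t x, u) = \sum_I T I t * Y I x 0 c.

Lemma slice_comb t x : J t -> U x -> slice xi t u x = \sum_I T I t *: Y I x.
Proof.
move=> Jt Ux; apply/rowP => c; rewrite [LHS]mxE summxE.
by apply: etrans (chiE Jt Ux c) _; apply: eq_bigr => I _; rewrite mxE.
Qed.

Lemma slice_dt_comb t x : J t -> U x ->
  slice_dt xi t u x = \sum_I (T I)^`()%classic t *: Y I x.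
Proof.
move=> Jt Ux; apply/rowP => c; rewrite [LHS]mxE summxE -derive_t_dpz.
apply: ddirE.
apply: (ddir_eq_on (f := fun s => \sum_I T I s * Y I x 0 c) oJ _ Jt).
  by move=> s Js; rewrite (chiE Js Ux).
apply: ddir_sum => I _; rewrite mxE derive1E.
have d : ddir t 1 (fun s => T I s * Y I x 0 c) _ :=
  ddirM (@smooth_ddir R R J (T I) t (1 : R) (sT I) Jt)
    (@ddir_cst R R t (1 : R) (Y I x 0 c)).
apply: ddir_eq d _.
by rewrite mulr0 addr0.
Qed.

Lemma slice_lie_metric t x a b : J t -> U x ->
  lie_metric (slice xi t u) g a b x = (\sum_I 2 * psi I * T I t) * g x a b.
Proof.
move=> Jt Ux.
rewrite (comb_lie_metric g oU basis_smooth (fun y => @slice_comb t y Jt) a b Ux).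
rewrite mulr_suml; apply: eq_bigr => I _.
by case: (hY I) => _ /(_ x Ux a b) ->; ring.
Qed.

Lemma slice_condition t x al : J t -> U x ->
  lie_covector (slice xi t u) (lower g C) al x - lower g (slice_dt xi t u) al x
  = \sum_I (T I t * lie_covector (Y I) (lower g C) al x
            - (T I)^`()%classic t * lower g (Y I) al x).
Proof.
move=> Jt Ux; rewrite sumrB.
rewrite (comb_lie_covector oU basis_smooth (fun y => @slice_comb t y Jt) _ al Ux).
by rewrite (comb_lower g (fun y => @slice_dt_comb t y Jt) al Ux).
Qed.

End Combination.

End SliceForm.

(** A diagonal entry of ginv g *m g = 1 recovers the factor; it exists because n > 0. *)
Lemma homothetic_factor (R : realType) n (U : set 'rV[R]_n) (g : 'rV[R]_n -> 'M[R]_n)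
    (x : 'rV[R]_n) (k l : R) :
  (0 < n)%N -> smooth_metric U g -> U x ->
  (forall a b, k * g x a b = l * g x a b) -> k = l.
Proof.
move=> n0 hg Ux h; apply/eqP; rewrite -subr_eq0; apply/eqP.
pose i := Ordinal n0.
have e : \sum_c ginv g x i c * g x c i = 1 by rewrite (ginv_mulV hg) // eqxx.
rewrite -[k - l]mulr1 -e mulr_sumr big1 // => c _.
by rewrite mulrCA mulrBl h subrr mulr0.
Qed.

Lemma derive_eq_on1 (R : realType) (D : set R) (f k : R -> R) (t l : R) :
  open D -> (forall s, D s -> f s = k s) -> D t ->
  ddir t (1 : R) f l -> 'D_1 k t = l.
Proof. by move=> oD fk Dt h; exact: ddirE (ddir_eq_on oD fk Dt h). Qed.

(** * Closed form of the symmetry vector *)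

Section SymmetryForm.
Variables (R : realType) (n : nat).
Hypothesis n_gt0 : (0 < n)%N.
Local Notation N := (1 + n)%N.
Variables (U : set 'rV[R]_n) (J W : set R).
Hypothesis hU : [/\ open U, connected U & U !=set0].
Hypothesis hJ : [/\ open J, is_interval J & J !=set0].
Hypothesis hW : [/\ open W, is_interval W & W !=set0].
Variables (g : 'rV[R]_n -> 'M[R]_n) (C : 'rV[R]_n -> 'rV[R]_n).
Hypotheses (hg : smooth_metric U g) (sC : smooth_field U C).
Local Notation M := (spacetime J U).
Variables (m : nat) (Y : 'I_m -> 'rV[R]_n -> 'rV[R]_n) (psi : 'I_m -> R).
Hypothesis hY : homothetic_basis U g Y psi.
Variables (xi : jet0 R N -> 'rV[R]_N) (eta : jet0 R N -> R).
Hypotheses (sxi : forall i, smooth_on (M `*` W) (fun w => xi w 0 i)).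
Hypotheses (seta : smooth_on (M `*` W) eta).
Local Notation tau := (fun w => xi w 0 (tidx n)).
Local Notation chi c := (fun w => xi w 0 (xidx c)).
Let oU : open U. Proof. by case: hU. Qed.
Let oJ : open J. Proof. by case: hJ. Qed.
Let oW : open W. Proof. by case: hW. Qed.
Let iW : is_interval W. Proof. by case: hW. Qed.
Let hYI I : homothetic U g (Y I) (psi I). Proof. by case: hY. Qed.

(** Unfolds to the right-hand side of the theorem, so both directions can be closed by
    conversion. *)
Definition symmetry_form (c1 c2 : R) (T S : 'I_m -> R -> R)
    (a b : 'rV[R]_N -> R) : Prop :=
  [/\ forall I, smooth_on J (T I) /\
        forall t, J t -> is_derive t 1 (S I) (T I t),
      smooth_on M a /\ smooth_on M b,
      forall t x u, J t -> U x -> W u ->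
        [/\ xi (pt t x, u) 0 (tidx n) = c1 + \sum_I 2 * psi I * S I t,
            forall al, xi (pt t x, u) 0 (xidx al) = \sum_I T I t * Y I x 0 al
          & eta (pt t x, u) = a (pt t x) * u + b (pt t x) + c2 * u],
      forall t x, J t -> U x -> evol_op g C a t x = 0 /\ evol_op g C b t x = 0
    & forall t x, J t -> U x -> forall al,
        \sum_I (T I t * lie_covector (Y I) (lower g C) al x
                - derive1 (T I) t * lower g (Y I) al x)
        - 2 * partial al (fun y => a (pt t y)) x = 0].

Section Forward.
Hypothesis det : forall w, (M `*` W) w -> determining_eqs g C xi eta w.
Variables (x0 : 'rV[R]_n) (t0 u0 : R).
Hypotheses (Ux0 : U x0) (Jt0 : J t0) (Wu0 : W u0).

Let Om t x u : J t -> U x -> W u -> (M `*` W) (pt t x, u).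
Proof. by move=> Jt Ux Wu; split => //; apply/spacetime_pt. Qed.

Let tau_t t := tau (pt t x0, u0).

Lemma tau_form t x u : J t -> U x -> W u -> tau (pt t x, u) = tau_t t.
Proof.
move=> Jt Ux Wu.
have e1 : tau (pt t x, u) = tau (pt t x, u0).
  apply: (constant_u oW iW (sxi (tidx n))) => //; last by apply/spacetime_pt.
  by move=> w /det[[]].
apply: etrans e1 _.
have cU : connected U by case: hU.
apply: (constant_x oU oJ cU (sxi (tidx n))) => //.
by move=> w /det[[]].
Qed.

Lemma chi_form t x u c : J t -> U x -> W u -> (chi c) (pt t x, u) = (chi c) (pt t x, u0).
Proof.
move=> Jt Ux Wu.
apply: (constant_u oW iW (sxi (xidx c))) => //; last by apply/spacetime_pt.
by move=> w /det[].
Qed.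

(** As eta_uu = 0 and W is an interval, eta_u is constant in u; this is the resulting expansion of
    eta about [u0]. *)
Lemma eta_form z u : M z -> W u ->
  eta (z, u) = dpu eta (z, u0) * u + (eta (z, u0) - dpu eta (z, u0) * u0).
Proof.
move=> Mz Wu; set A := dpu eta (z, u0).
have sA : smooth_on (M `*` W) (dpu eta) by exact: smooth_derive.
have dA v : W v -> ddir v 1 (fun v => eta (z, v) - A * v) 0.
  move=> Wv; have e : dpu eta (z, v) = A.
    apply: (constant_u oW iW sA) => //.
    by move=> w /det[].
  have d : ddir v 1 (fun v => eta (z, v) - A * v) (dpu eta (z, v) - A * 1).
    apply: ddirB; first exact: (ddir_slice_u seta Mz Wv).
    by apply: ddirMl; exact: is_derive_id.
  by apply: ddir_eq d _; rewrite e mulr1 subrr.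
have := interval_constant oW iW dA Wu Wu0.
move: (eta (z, u)) (eta (z, u0)) => p q h.
by rewrite -h; ring.
Qed.

Lemma tau_dt t x u : J t -> U x -> W u -> dpz (tidx n) tau (pt t x, u) = 'D_1 tau_t t.
Proof.
move=> Jt Ux Wu; apply: etrans (esym (derive_t_dpz tau t x u)) _.
have h s : J s -> tau (pt s x, u) = tau_t s by move=> Js; exact: tau_form.
exact: (@derive_eq_on R R J (fun s => tau (pt s x, u)) tau_t (1 : R) oJ h t Jt).
Qed.

(** Since tau depends on t alone, the factor is constant in x: the slice is homothetic and not
    merely conformal. *)
Lemma slice_homothetic t : J t -> homothetic U g (slice xi t u0) ('D_1 tau_t t / 2).
Proof.
move=> Jt; split; first exact: (slice_smooth oU oJ sxi Jt Wu0).
move=> x Ux a b.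
have h := (metric_eq_lie oU hg xi Jt Ux Wu0).1.
have aux (d : R) : d = 2 * (d / 2) by field.
rewrite h; first by rewrite tau_dt //; congr (_ * _); exact: aux.
by case: (det (Om Jt Ux Wu0)).
Qed.

(** For each t the coefficients solve a linear system whose invertible matrix [B] does not depend on
    t and whose right-hand side consists of components of xi at fixed points. The solution is
    therefore smooth in t. *)
Lemma slice_coefficients : exists T : 'I_m -> R -> R,
  (forall I, smooth_on J (T I)) /\
  (forall t x, J t -> U x -> forall c, (chi c) (pt t x, u0) = \sum_I T I t * Y I x 0 c).
Proof.
have [_ indep span] := hY.
have [p [Up uB]] := independent_evaluations indep.
set B := \matrix_(_, _) _ in uB.
exists (fun I t => \sum_j invmx B I j * (chi (p j).2) (pt t (p j).1, u0)); split.
  move=> I; apply: (smooth_sum oJ) => j _; apply: (smoothM oJ).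
    exact: smooth_cst.
  exact: (smooth_slice_t oJ (Up j) (smooth_slice_u oU oJ Wu0 (sxi (xidx (p j).2)))).
move=> t x Jt Ux c.
have [k kE] := span _ _ (slice_homothetic Jt).
have chik y d : U y -> (chi d) (pt t y, u0) = \sum_I k I * Y I y 0 d.
  by move=> Uy; have := comb_coord kE d Uy; rewrite mxE.
apply: etrans (chik x c Ux) _; apply: eq_bigr => I _; congr (_ * _).
transitivity ((invmx B *m (B *m \col_I k I)) I 0).
  by rewrite mulmxA mulVmx // mul1mx mxE.
rewrite mxE; apply: eq_bigr => j _; congr (_ * _).
rewrite mxE; apply: etrans (esym (chik _ _ (Up j))).
by apply: eq_bigr => I' _; rewrite [in LHS]mxE [in X in _ * X]mxE mulrC.
Qed.

Lemma determining_form : exists c1 c2 T S a b, symmetry_form c1 c2 T S a b.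
Proof.
have [T [sT chiE]] := slice_coefficients.
(* The Lie derivative of g along the slice is computed from the expansion and from tau_t; the two
   factors must agree. *)
have facE t : J t -> \sum_I 2 * psi I * T I t = 'D_1 tau_t t.
  move=> Jt; apply: (homothetic_factor n_gt0 hg Ux0) => a b.
  rewrite -(slice_lie_metric oU hYI chiE a b Jt Ux0).
  have [_ h] := slice_homothetic Jt; rewrite h //.
  have aux (d : R) : 2 * (d / 2) = d by field.
  by congr (_ * _); exact: aux.
have /choice[S dS] : forall I, exists S, forall t, J t -> is_derive t 1 S (T I t).
  move=> I; apply: antiderivative => //; [by case: hJ|by case: hJ|].
  move=> t Jt; apply: differentiable_continuous.
  exact: (smooth_differentiable (sT I) Jt).
pose c1 := tau_t t0 - \sum_I 2 * psi I * S I t0.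
pose A z := dpu eta (z, u0); pose B z := eta (z, u0) - A z * u0.
have sA : smooth_on M A by apply: (smooth_slice_u oU oJ Wu0 (smooth_derive _ seta)).
have sB : smooth_on M B.
  apply: smoothB; [exact: spacetime_open|exact: (smooth_slice_u oU oJ Wu0 seta)|].
  by apply: smoothM => //; [exact: spacetime_open|apply: smooth_cst; exact: spacetime_open].
(* The value c_2 = 0 suffices, since [A], the whole of eta_u, already contains any constant multiple
   of u. [c1] matches tau at [t0] to the chosen antiderivatives. *)
exists c1, 0, T, S, A, B; split.
- by move=> I; split; [exact: sT|exact: dS].
- by split.
- move=> t x u Jt Ux Wu; split.
  + apply: etrans (tau_form Jt Ux Wu) _.
    have dd s : J s -> ddir s 1 (fun s => tau_t s - \sum_I 2 * psi I * S I s) 0.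
      move=> Js; apply: (@ddir_eq _ _ _ _ _ ('D_1 tau_t s - \sum_I 2 * psi I * T I s)).
        apply: ddirB; last by apply: ddir_sum => I _; apply: ddirMl; exact: dS.
        have := ddir_slice_t (sxi (tidx n)) Js Ux0 Wu0.
        by rewrite (tau_dt Js Ux0 Wu0).
      by rewrite facE // subrr.
    have iJ : is_interval J by case: hJ.
    have := interval_constant oJ iJ dd Jt Jt0; rewrite -/c1 => <-.
    by rewrite subrK.
  + by move=> al; apply: etrans (chi_form al Jt Ux Wu) _; exact: chiE.
  + have Mz : M (pt t x) by apply/spacetime_pt.
    by rewrite mul0r addr0; exact: eta_form.
(* The evolution equation for eta at fixed u is affine in u, so it splits into the equations for [A]
   and [B]. *)
- move=> t x Jt Ux; apply: (affine_eq0 oW); first by exists u0.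
  move=> u Wu.
  have := evol_op_lin (f := fun z => eta (z, u)) (k := u) (c := 0) oU oJ C hg sA sB _ Jt Ux.
  move=> <-; last first.
    by move=> z Mz; rewrite addr0 mulrC; exact: eta_form.
  rewrite -(cst_evol oU oJ C hg seta Jt Ux Wu).
  by have [_ _ _ _ []] := det (Om Jt Ux Wu).
- move=> t x Jt Ux al.
  rewrite -(slice_condition oU oJ C hYI sT chiE al Jt Ux).
  apply: (drift_eq_lie oU oJ hg sC eta sxi Jt Wu0 _ _ Ux).1.
  + by move=> y Uy; exact: tau_dt.
  + move=> y Uy a b; have [_ h] := slice_homothetic Jt; rewrite h //.
    have aux (d : R) : 2 * (d / 2) = d by field.
    by congr (_ * _); exact: aux.
  + by have [_ _ _ _ []] := det (Om Jt Ux Wu0).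
Qed.

End Forward.

Lemma form_determining c1 c2 T S a b : symmetry_form c1 c2 T S a b ->
  forall w, (M `*` W) w -> determining_eqs g C xi eta w.
Proof.
move=> [hTS [sa sb] hform hevol hcond].
have sT I : smooth_on J (T I) by case: (hTS I).
have tauE t x u : J t -> U x -> W u -> tau (pt t x, u) = c1 + \sum_I 2 * psi I * S I t.
  by move=> Jt Ux Wu; case: (hform t x u Jt Ux Wu).
have chiE u : W u -> forall t x, J t -> U x -> forall c,
    (chi c) (pt t x, u) = \sum_I T I t * Y I x 0 c.
  by move=> Wu t x Jt Ux c; case: (hform t x u Jt Ux Wu).
have etaE z u : M z -> W u -> eta (z, u) = u * a z + b z + c2 * u.
  rewrite -(ptK z) => /spacetime_pt[Jt Ux] Wu.
  by case: (hform _ _ _ Jt Ux Wu) => _ _ ->; rewrite (mulrC u).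
have cst_u F z u k : M z -> W u -> smooth_on (M `*` W) F ->
    (forall v, W v -> F (z, v) = k) -> dpu F (z, u) = 0.
  move=> Mz Wu sF Fk; rewrite -(ddirE (ddir_slice_u sF Mz Wu)).
  apply: (derive_eq_on1 (f := fun=> k) oW _ Wu); last exact: ddir_cst.
  by move=> v Wv; rewrite Fk.
have dpu_eta z u : M z -> W u -> dpu eta (z, u) = a z + c2.
  move=> Mz Wu; rewrite -(ddirE (ddir_slice_u seta Mz Wu)).
  apply: (derive_eq_on1 (f := fun u => u * a z + b z + c2 * u) oW _ Wu).
    by move=> v Wv; rewrite etaE.
  have did : ddir u (1 : R) (fun v : R => v) 1 := is_derive_id u (1 : R).
  have d : ddir u (1 : R) (fun u => u * a z + b z + c2 * u) (1 * a z + u * 0 + 0 + c2 * 1).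
    apply: ddirD; last exact: ddirMl.
    by apply: ddirD; [apply: ddirM => //|]; exact: ddir_cst.
  by apply: ddir_eq d _; ring.
have dS t : J t -> ddir t (1 : R) (fun t => c1 + \sum_I 2 * psi I * S I t)
    (\sum_I 2 * psi I * T I t).
  move=> Jt; rewrite -[X in ddir _ _ _ X]add0r; apply: ddirD; first exact: ddir_cst.
  by apply: ddir_sum => I _; apply: ddirMl; case: (hTS I) => _; exact.
have tau_dtE t x u : J t -> U x -> W u ->
    dpz (tidx n) tau (pt t x, u) = \sum_I 2 * psi I * T I t.
  move=> Jt Ux Wu; rewrite -(ddirE (ddir_slice_t (sxi (tidx n)) Jt Ux Wu)).
  by apply: (derive_eq_on1 oJ _ Jt (dS t Jt)) => s Js; rewrite -(tauE s x u).
move=> [z u] [/= Mz Wu].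
have [Jt Ux] : J (z 0 (tidx n)) /\ U (xpart z) by [].
move: Mz; rewrite -(ptK z) in Jt Ux *; rewrite pt_tidx in Jt; rewrite xpart_pt in Ux.
move: (z 0 (tidx n)) (xpart z) Jt Ux => t x Jt Ux Mz {z}.
have lieE y i j : U y -> lie_metric (slice xi t u) g i j y
    = (\sum_I 2 * psi I * T I t) * g y i j.
  by move=> Uy; exact: (slice_lie_metric oU hYI (chiE u Wu) i j Jt Uy).
split.
- split; first by apply: cst_u (sxi (tidx n)) _ => // v Wv; exact: tauE.
  move=> d; have e := congr1 (fun f : 'rV[R]_n -> R => f x) (partial_dpz tau t u d).
  apply: etrans (esym e) _; apply: ddirE.
  apply: (ddir_eq_on (f := fun=> c1 + \sum_I 2 * psi I * S I t) oU _ Ux).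
    by move=> y Uy; rewrite -(tauE t y u).
  exact: ddir_cst.
- by move=> c; apply: cst_u (sxi (xidx c)) _ => // v Wv; exact: (chiE v Wv t x Jt Ux c).
- apply: (cst_u _ _ _ (a (pt t x) + c2)) => //; first exact: smooth_derive.
  by move=> v Wv; exact: dpu_eta.
- move=> i j; apply: (metric_eq_lie oU hg xi Jt Ux Wu).2 => k l.
  by rewrite lieE // tau_dtE.
- split; last first.
    rewrite (cst_evol oU oJ C hg seta Jt Ux Wu).
    rewrite (evol_op_lin (f := fun z => eta (z, u)) (k := u) (c := c2 * u) oU oJ C hg
      sa sb _ Jt Ux); last by move=> z Mz'; exact: etaE.
    by have [-> ->] := hevol t x Jt Ux; rewrite mulr0 addr0.
  apply: (drift_eq_lie oU oJ hg sC eta sxi Jt Wu _ (fun y Uy i j => lieE y i j Uy) Ux).2.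
    by move=> y Uy; exact: tau_dtE.
  move=> al; rewrite (slice_condition oU oJ C hYI sT (chiE u Wu) al Jt Ux).
  rewrite -[RHS](hcond t x Jt Ux al); congr (_ - 2 * _).
  (* eta_u is a + c_2, and the constant disappears from its gradient. *)
  rewrite -[RHS]addr0; apply: ddirE.
  apply: (ddir_eq_on (f := fun y => a (pt t y) + c2) oU _ Ux).
    by move=> y Uy; rewrite dpu_eta //; apply/spacetime_pt.
  apply: ddirD; last exact: ddir_cst.
  exact: (smooth_ddir _ (smooth_slice_x oU Jt sa) Ux).
Qed.

End SymmetryForm.
Theorem theorem1 (R : realType) (n : nat) (hn : (0 < n)%N)
    (* coordinate domain U of the x^a, open intervals J of t and W of u *)
    (U : set 'rV[R]_n) (J W : set R)
    (hU : [/\ open U, connected U & U !=set0])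
    (hJ : [/\ open J, is_interval J & J !=set0])
    (hW : [/\ open W, is_interval W & W !=set0])
    (g : 'rV[R]_n -> 'M[R]_n) (hg : smooth_metric U g)
    (C : 'rV[R]_n -> 'rV[R]_n) (hC : smooth_field U C)
    (m : nat) (Y : 'I_m -> 'rV[R]_n -> 'rV[R]_n) (psi : 'I_m -> R)
    (hY : homothetic_basis U g Y psi) (hpsi : killing_or_proper psi)
    (xi : 'rV[R]_(1 + n) * R -> 'rV[R]_(1 + n))
    (eta : 'rV[R]_(1 + n) * R -> R)
    (hxi : forall i, smooth_on (spacetime J U `*` W) (fun w => xi w 0 i))
    (heta : smooth_on (spacetime J U `*` W) eta) :
  lie_point_symmetry (spacetime J U `*` W) (evol_eq g C) xi eta
  <->
  exists (c1 c2 : R) (T S : 'I_m -> R -> R) (a b : 'rV[R]_(1 + n) -> R),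
    [/\ (* S I is an antiderivative of T I *)
        forall I, smooth_on J (T I) /\
          forall t, J t -> is_derive t 1 (S I) (T I t),
        smooth_on (spacetime J U) a /\ smooth_on (spacetime J U) b,
        forall t x u, J t -> U x -> W u ->
          [/\ xi (pt t x, u) 0 (tidx n) = c1 + \sum_I 2 * psi I * S I t,
              forall al, xi (pt t x, u) 0 (xidx al)
                         = \sum_I T I t * Y I x 0 al
            & eta (pt t x, u) = a (pt t x) * u + b (pt t x) + c2 * u],
        forall t x, J t -> U x ->
          evol_op g C a t x = 0 /\ evol_op g C b t x = 0
      & forall t x, J t -> U x -> forall al,
          \sum_I (T I t * lie_covector (Y I) (lower g C) al x
                  - derive1 (T I) t * lower g (Y I) al x)
          - 2 * partial al (fun y => a (pt t y)) x = 0].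
Proof.
have oU : open U by case: hU.
have oJ : open J by case: hJ.
have oW : open W by case: hW.
have oOm := spacetimeW_open oU oJ oW.
have OmU (w : jet0 R (1 + n)) : (spacetime J U `*` W) w -> U (xpart w.1) by case=> -[].
split=> [sym|[c1 [c2 [T [S [a [b form]]]]]]].
  have det := symmetry_determining oU hg hC oOm OmU hxi heta hn sym.
  case: (hU) (hJ) (hW) => _ _ [x0 Ux0] [_ _ [t0 Jt0]] [_ _ [u0 Wu0]].
  exact: (determining_form hn hU hJ hW hg hC hY hxi heta det Ux0 Jt0 Wu0).
apply: (determining_symmetry oU hg hC oOm OmU hxi heta).
exact: (form_determining hU hJ hW hg hC hY hxi heta form).
Qed.
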